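(* For every integer $t$ there exist a constant $C=C(t)$ and a first-order formula $\psi_t(x;y_1,\dots,y_{l_t})$ in the language of ordered graphs (depending only on $t$, with $l_t=O(t)$) such that the following holds. For every finite graph $G$ with a $t$-proper order $\preceq$, every $A\subseteq V(G)$ of size $n$ and every real $r$ with $1\le r\le n$, the set $V(G)$ can be partitioned into sets $X_1,\dots,X_l$ with $l\le C r^{O(t)}$ such that for every $X_i$ there are at most $n/r$ vertices $a\in A$ which cross $X_i$, i.e. for which there exist $x,x'\in X_i$ with $E(x,a)$ and $\neg E(x',a)$. Moreover, each $X_i$ is an intersection of at most two sets of the form $\{v\in V(G):(G,\preceq)\models\psi_t(v;\bar a)\}$ with $\bar a\in A^{l_t}$.
   Context: Graphs are finite, undirected and simple. The language of ordered graphs has binary symbols $E$ (adjacency) and $\preceq$ (a total order). For a finite graph $G$, a total order $\preceq$ on $V(G)$ is a $t$-proper order if the adjacency matrix of $G$ with rows and columns ordered by $\preceq$ is $(t+2)$-symmetric-twin-ordered: contracting columns $i,j$ deletes column $j$ and replaces each entry of column $i$ by a red symbol where the two columns differ (similarly for rows); a symmetric contraction contracts rows $i,j$ and then columns $i,j$; the matrix is $k$-symmetric-twin-ordered if some sequence of symmetric contractions, each identifying consecutive rows and consecutive columns, reaches a $1\times1$ matrix with every intermediate matrix having at most $k$ red entries in each row and each column. *)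

(* Defs.v *)
From HB Require Import structures.
From mathcomp Require Import all_boot all_order all_algebra.
From mathcomp Require Import reals.

Set Implicit Arguments.
Unset Strict Implicit.
Unset Printing Implicit Defensive.

Import Order.TTheory GRing.Theory Num.Theory.

(* Entries are [Some b] for an ordinary 0/1 entry and [None] for the red
   symbol. *)
Definition entry : Type := option bool.
Definition red : entry := None.

Section Contraction.

Variables (m n : nat).

(* As symbols, two red entries agree, so merging them yields red again. *)
Definition contract_cols (i j : 'I_n) (M : 'M[entry]_(m, n)) :
    'M[entry]_(m, n.-1) :=
  col' j (\matrix_(p, q)
    if q == i then if M p i == M p j then M p i else red else M p q).

End Contraction.

Definition contract_rows m n (i j : 'I_m) (M : 'M[entry]_(m, n)) :
    'M[entry]_(m.-1, n) :=
  ((contract_cols i j M^T)^T)%R.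

Definition sym_contract n (i j : 'I_n) (M : 'M[entry]_n) : 'M[entry]_n.-1 :=
  contract_cols i j (contract_rows i j M).

Definition red_bounded (k : int) m n (M : 'M[entry]_(m, n)) : Prop :=
  (forall i, (#|[set j | M i j == red]|%:Z <= k)%R) /\
  (forall j, (#|[set i | M i j == red]|%:Z <= k)%R).

(* The red bound is imposed on every matrix obtained after a whole symmetric
   contraction (including the first and last ones), not on the rectangular
   matrix between its row step and its column step. *)
Inductive sym_twin_ordered (k : int) : forall n, 'M[entry]_n -> Prop :=
| STO_end (M : 'M[entry]_1) : red_bounded k M -> sym_twin_ordered k M
| STO_step n (M : 'M[entry]_n) (i j : 'I_n) :
    j = i.+1 :> nat -> red_bounded k M ->
    sym_twin_ordered k (sym_contract i j M) -> sym_twin_ordered k M.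

Definition simple_graph (V : finType) (E : rel V) : Prop :=
  symmetric E /\ irreflexive E.

Definition total_order (V : finType) (le : rel V) : Prop :=
  [/\ reflexive le, antisymmetric le, transitive le & total le].

Definition adj_mx (V : finType) (E : rel V) (s : seq V) :
    'M[entry]_(size s) :=
  (\matrix_(i, j) Some (E (tnth (in_tuple s) i) (tnth (in_tuple s) j)))%R.

Definition proper_order (t : int) (V : finType) (E le : rel V) : Prop :=
  total_order le /\
  sym_twin_ordered (t + 2)%R (adj_mx E (sort le (enum V))).

(* First-order formulas over ordered graphs, with free variables in ['I_n].
   A quantifier binds variable 0 of its body and shifts the other ones. *)
Inductive formula : nat -> Type :=
| FEq n (i j : 'I_n) : formula n
| FAdj n (i j : 'I_n) : formula n
| FLe n (i j : 'I_n) : formula n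
| FNot n (phi : formula n) : formula n
| FAnd n (phi psi : formula n) : formula n
| FOr n (phi psi : formula n) : formula n
| FEx n (phi : formula n.+1) : formula n
| FAll n (phi : formula n.+1) : formula n.

Fixpoint sat (V : finType) (E le : rel V) n (phi : formula n) :
    n.-tuple V -> bool :=
  match phi in formula n return n.-tuple V -> bool with
  | FEq _ i j => fun e => tnth e i == tnth e j
  | FAdj _ i j => fun e => E (tnth e i) (tnth e j)
  | FLe _ i j => fun e => le (tnth e i) (tnth e j)
  | FNot _ p => fun e => ~~ sat E le p e
  | FAnd _ p q => fun e => sat E le p e && sat E le q e
  | FOr _ p q => fun e => sat E le p e || sat E le q e
  | FEx _ p => fun e => [exists v, sat E le p [tuple of v :: e]]
  | FAll _ p => fun e => [forall v, sat E le p [tuple of v :: e]]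
  end.

(* Variable 0 of [psi] is the object variable, the others are parameters. *)
Definition defset (V : finType) (E le : rel V) l (psi : formula l.+1)
    (a : l.-tuple V) : {set V} :=
  [set v | sat E le psi [tuple of v :: a]].

Definition crosses (V : finType) (E : rel V) (a : V) (X : {set V}) : bool :=
  [exists x in X, exists x' in X, E x a && ~~ E x' a].

(* Main.v *)
Require Import Defs.
From mathcomp Require Import all_boot all_order all_algebra zify.
From mathcomp Require Import reals.

(* Let S consist of every m-th element of A, with m about n / (4 k r) and k =
   |t| + 2. The class of a vertex v records its adjacencies to S and the set L
   of its breaks, the gaps between consecutive elements of S on which its row
   is not constant. The breaks cut the columns into cells on which, up to a
   final gap, the row of v is constant. Undoing the contractions down to the
   first stage at which some part contains a whole break, the rows nonconstant
   on that break lie in at most k parts, and the rows of one part differ on at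
   most 4 k cells. So the rows nonconstant on that break, in the order of the
   graph, can be cut greedily into at most k runs, each of which touches at
   most 4 k cells, and the vertices of the class of v that lie in a given run
   are described by these cells, which are definable from elements of S,
   together with the first element of the run. Two rows of such a set agree
   outside the final gaps of at most 4 k cells, which contain few elements of
   A.

   It remains to define the first element of a run by O(t) parameters,
   although each of the k runs comes with its own set of up to 4 k cells. One
   reaches it by jumps: a jump for a set F of cells goes from a point to the
   end of the next row interval touching exactly F. If R is the set of cells
   of the run to be passed, R-jumps can only be trapped inside an earlier run
   whose set of cells properly contains R; starting after the last such run,
   and reaching that run recursively, one uses a decreasing chain of sets,
   which is encoded by a single list of at most 4 k cells interleaved with at
   most k jumps. *)

Set Implicit Arguments.
Unset Strict Implicit.
Unset Printing Implicit Defensive.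

Import Order.TTheory GRing.Theory Num.Theory.

(** * First-order definability *)

Section Predicates.
Variables (V : finType) (E le : rel V).

Definition nonconst (F : rel V) (x a b : V) : bool :=
  [exists z, exists z',
    [&& le a z, le z b, le a z', le z' b, F x z & ~~ F x z']].

(** This is [nonconst] for the transposed relation: a column is read along an interval of rows. *)
Definition splits (z u y : V) : bool := nonconst (fun a b => E b a) z u y.

(* A cell [(lo, hi)] is the half-open interval from [lo] to [hi]; [hi = lo]
   stands for an interval without upper end, and [hi < lo] for no cell. *)
Definition incell (c : V * V) (z : V) : bool :=
  le c.1 z && (~~ le c.2 z || (c.2 == c.1)).

(** The bound [m] will be the first element of [S]: columns before it belong to no cell, and no
    element of [A] lies there. *)
Definition touches (m : V) (c : V * V) (u y : V) : bool :=
  [exists z, [&& le m z, incell c z & splits z u y]].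

Definition touches_outside (m : V) (cs : seq (V * V)) (u y : V) : bool :=
  [exists z, [&& le m z, ~~ has (fun c => incell c z) cs & splits z u y]].

(** Entries with [c.2] before [c.1] are jump instructions, which name no cell and are skipped. *)
Definition touches_exactly (m : V) (cs : seq (V * V)) (u y : V) : bool :=
  all (fun c => ~~ le c.1 c.2 || touches m c u y) cs && ~~ touches_outside m cs
    u y.

(** The parameters [p] and [h] are the ends of the break in use; only rows nonconstant on it count
    as ends of intervals. The least candidate is where the jump lands. *)
Definition jump_candidate (m p h : V) (cs : seq (V * V)) (c y : V) : bool :=
  [exists u, exists w, [&& nonconst E u p h, nonconst E w p h, le c u, le u w,
    le w y,
    touches_exactly m cs u w & touches_outside m cs u y]].

Definition jump (m p h : V) (cs : seq (V * V)) (c y : V) : bool :=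
  [&& nonconst E y p h, jump_candidate m p h cs c y &
    [forall y', (nonconst E y' p h && jump_candidate m p h cs c y') ==> le y
      y']].

(* Entries [(lo, hi)] with [hi < lo] are jump instructions; a jump uses the
   cells listed after it. *)
Fixpoint reach (m p h : V) (es : seq (V * V)) (c d : V) : bool :=
  if es is e :: es' then
    (le e.1 e.2 && reach m p h es' c d) ||
    (~~ le e.1 e.2 && [exists c', jump m p h es' c c' && reach m p h es' c' d])
  else c == d.

Definition first_split (p h d : V) : bool :=
  nonconst E d p h && [forall y, nonconst E y p h ==> le d y].

(* The parameter [sg] codes a bit, which is 1 iff [sg = lo]. *)
Definition row_ok (x : V) (g : V * V * V * V) : bool :=
  let: (lo, mid, hi, sg) := g in
  [forall z, (le lo z && le z mid) ==> (E x z == (sg == lo))] &&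
  (le hi lo || nonconst E x mid hi).

Definition ends (g : V * V * V * V) : V * V := (g.1.1.1, g.1.2).

(* [m = c], unavoidable when [A] is a singleton, codes the whole vertex set, and
   [p = h] codes a class without breaks. *)
Definition cell_pred (m c p h : V) (es : seq (V * V))
    (gs : seq (V * V * V * V)) (x : V) : bool :=
  (m == c) || all (row_ok x) gs && ((p == h) || nonconst E x p h &&
    [exists d0, exists d, [&& first_split p h d0, reach m p h es d0 d, le d x
       & ~~ touches_outside m (map ends gs) d x]]).

End Predicates.

(** * Uniform definability of these predicates *)

Section Definability.

Definition pred_on n := forall V : finType, rel V -> rel V -> ('I_n -> V) ->
  bool.

(** The formula is chosen before the graph, so that one formula serves all ordered graphs. *)
Definition fo n (Q : pred_on n) : Prop :=
  exists phi : formula n, forall (V : finType) (E le : rel V) (e : n.-tuple V),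
    sat E le phi e = Q V E le (tnth e).

Lemma fo_eq n (i j : 'I_n) : fo (fun V E le r => r i == r j).
Proof. by exists (FEq i j). Qed.

Lemma fo_adj n (i j : 'I_n) : fo (fun V E le r => E (r i) (r j)).
Proof. by exists (FAdj i j). Qed.

Lemma fo_le n (i j : 'I_n) : fo (fun V E le r => le (r i) (r j)).
Proof. by exists (FLe i j). Qed.

Lemma fo_not n (Q : pred_on n) : fo Q -> fo (fun V E le r => ~~ Q V E le r).
Proof. by case=> phi h; exists (FNot phi) => V E le e /=; rewrite h. Qed.

Lemma fo_and n (Q1 Q2 : pred_on n) : fo Q1 -> fo Q2 ->
  fo (fun V E le r => Q1 V E le r && Q2 V E le r).
Proof.
by case=> p1 h1 [p2 h2]; exists (FAnd p1 p2) => V E le e /=; rewrite h1 h2.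
Qed.

Lemma fo_or n (Q1 Q2 : pred_on n) : fo Q1 -> fo Q2 ->
  fo (fun V E le r => Q1 V E le r || Q2 V E le r).
Proof.
by case=> p1 h1 [p2 h2]; exists (FOr p1 p2) => V E le e /=; rewrite h1 h2.
Qed.

Lemma fo_ext n (Q1 Q2 : pred_on n) : fo Q1 ->
  (forall (V : finType) (E le : rel V) (e : n.-tuple V), Q1 V E le (tnth e) =
    Q2 V E le (tnth e)) ->
  fo Q2.
Proof. by case=> p h eqQ; exists p => V E le e; rewrite h eqQ. Qed.

(** Here [Q] is the body with the bound vertex as variable 0, and [B] the same body with that vertex
    as an argument, the form in which the predicates above are written. The second hypothesis undoes
    the shift of variables. *)
Lemma fo_ex n (Q : pred_on n.+1)
    (B : forall V : finType, rel V -> rel V -> ('I_n -> V) -> V -> bool) :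
  fo Q ->
  (forall (V : finType) (E le : rel V) (e : n.-tuple V) (v : V),
     Q V E le (tnth [tuple of v :: e]) = B V E le (tnth e) v) ->
  fo (fun V E le r => [exists v, B V E le r v]).
Proof.
case=> p h eqQ; exists (FEx p) => V E le e /=.
by apply: eq_existsb => v; rewrite h eqQ.
Qed.

Lemma fo_all n (Q : pred_on n.+1)
    (B : forall V : finType, rel V -> rel V -> ('I_n -> V) -> V -> bool) :
  fo Q ->
  (forall (V : finType) (E le : rel V) (e : n.-tuple V) (v : V),
     Q V E le (tnth [tuple of v :: e]) = B V E le (tnth e) v) ->
  fo (fun V E le r => [forall v, B V E le r v]).
Proof.
case=> p h eqQ; exists (FAll p) => V E le e /=.
by apply: eq_forallb => v; rewrite h eqQ.
Qed.

Definition shift n (i : 'I_n) : 'I_n.+1 := lift ord0 i.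
Definition shift2 n (c : 'I_n * 'I_n) : 'I_n.+1 * 'I_n.+1 := (shift c.1, shift
  c.2).
Definition at2 n (V : finType) (r : 'I_n -> V) (c : 'I_n * 'I_n) : V * V :=
  (r c.1, r c.2).

Lemma tnth_shift n (V : finType) (v : V) (e : n.-tuple V) i :
  tnth [tuple of v :: e] (shift i) = tnth e i.
Proof. exact: tnthS. Qed.

Lemma at2_shift n (V : finType) (v : V) (e : n.-tuple V) c :
  at2 (tnth [tuple of v :: e]) (shift2 c) = at2 (tnth e) c.
Proof. by rewrite /at2 /= !tnth_shift. Qed.

Lemma map_at2_shift n (V : finType) (v : V) (e : n.-tuple V) cs :
  map (at2 (tnth [tuple of v :: e])) (map (@shift2 n) cs) = map (at2 (tnth e))
    cs.
Proof. by rewrite -map_comp; apply: eq_map => c; apply: at2_shift. Qed.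

Definition tnth_shiftE := (tnth_shift, at2_shift, map_at2_shift, tnth0).

(** The formula is [x = x] for a free variable [x], hence the nonempty context here and in what
    follows from it. *)
Lemma fo_true n : fo (fun V E le (r : 'I_n.+1 -> V) => true).
Proof. by apply: (fo_ext (fo_eq ord0 ord0)) => V E le e; rewrite eqxx. Qed.

Lemma fo_false n : fo (fun V E le (r : 'I_n.+1 -> V) => false).
Proof. by apply: (fo_ext (fo_not (fo_true n))). Qed.

Lemma fo_all_seq n (T : Type) (s : seq T) (Q : T -> pred_on n.+1) :
  (forall i, fo (Q i)) ->
  fo (fun V E le r => all (fun i => Q i V E le r) s).
Proof.
move=> foQ; elim: s => [|i s IH] /=; first exact: fo_true.
exact: fo_and.
Qed.

Lemma fo_has_seq n (T : Type) (s : seq T) (Q : T -> pred_on n.+1) :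
  (forall i, fo (Q i)) ->
  fo (fun V E le r => has (fun i => Q i V E le r) s).
Proof.
move=> foQ; elim: s => [|i s IH] /=; first exact: fo_false.
exact: fo_or.
Qed.

Ltac fo_step := first
  [ exact: fo_eq | exact: fo_adj | exact: fo_le
  | apply: fo_not | apply: fo_and | apply: fo_or ].

Lemma fo_nonconst n (x a b : 'I_n) :
  fo (fun V E le r => nonconst le E (r x) (r a) (r b)).
Proof.
apply: (@fo_ex _ (fun V E le r => [exists z',
    [&& le (r (shift a)) (r ord0), le (r ord0) (r (shift b)), le (r (shift a))
      z',
     le z' (r (shift b)), E (r (shift x)) (r ord0) & ~~ E (r (shift x)) z']])).
  apply: (@fo_ex _ (fun V E le r =>
    [&& le (r (shift (shift a))) (r (shift ord0)), le (r (shift ord0)) (r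
      (shift (shift b))),
     le (r (shift (shift a))) (r ord0), le (r ord0) (r (shift (shift b))),
     E (r (shift (shift x))) (r (shift ord0)) & ~~ E (r (shift (shift x))) (r
       ord0)])).
    by repeat fo_step.
  by move=> V E le e v; rewrite !tnth_shiftE.
by move=> V E le e v; apply: eq_existsb => z; rewrite !tnth_shiftE.
Qed.

Lemma fo_splits n (z u y : 'I_n) :
  fo (fun V E le r => splits E le (r z) (r u) (r y)).
Proof.
apply: (@fo_ex _ (fun V E le r => [exists z',
    [&& le (r (shift u)) (r ord0), le (r ord0) (r (shift y)), le (r (shift u))
      z',
     le z' (r (shift y)), E (r ord0) (r (shift z)) & ~~ E z' (r (shift z))]])).
  apply: (@fo_ex _ (fun V E le r =>
    [&& le (r (shift (shift u))) (r (shift ord0)), le (r (shift ord0)) (r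
      (shift (shift y))),
     le (r (shift (shift u))) (r ord0), le (r ord0) (r (shift (shift y))),
     E (r (shift ord0)) (r (shift (shift z))) & ~~ E (r ord0) (r (shift (shift
       z)))])).
    by repeat fo_step.
  by move=> V E le e v; rewrite !tnth_shiftE.
by move=> V E le e v; rewrite !tnth_shiftE.
Qed.

Lemma fo_incell n (c : 'I_n * 'I_n) (z : 'I_n) :
  fo (fun V E le r => incell le (at2 r c) (r z)).
Proof. by repeat fo_step. Qed.

Lemma fo_touches n (m : 'I_n) (c : 'I_n * 'I_n) (u y : 'I_n) :
  fo (fun V E le r => touches E le (r m) (at2 r c) (r u) (r y)).
Proof.
apply: (@fo_ex _ (fun V E le r => [&& le (r (shift m)) (r ord0),
  incell le (at2 r (shift2 c)) (r ord0) & splits E le (r ord0) (r (shift u)) (r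
    (shift y))])).
  by do ?[exact: fo_incell | exact: fo_splits | fo_step].
by move=> V E le e v; rewrite !tnth_shiftE.
Qed.

Lemma fo_touches_outside n (m : 'I_n.+1) (cs : seq ('I_n.+1 * 'I_n.+1)) (u y :
  'I_n.+1) :
  fo (fun V E le r => touches_outside E le (r m) (map (at2 r) cs) (r u) (r y)).
Proof.
apply: (@fo_ex _ (fun V E le r => [&& le (r (shift m)) (r ord0),
  ~~ has (fun c => incell le (at2 r (shift2 c)) (r ord0)) cs
  & splits E le (r ord0) (r (shift u)) (r (shift y))])).
  do ?[exact: fo_splits | fo_step].
  by apply: fo_has_seq => c; apply: fo_incell.
move=> V E le e v; rewrite !tnth_shiftE has_map; congr [&& _, ~~ _ & _].
by apply: eq_has => c; rewrite !tnth_shiftE.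
Qed.

Lemma fo_touches_exactly n (m : 'I_n.+1) (cs : seq ('I_n.+1 * 'I_n.+1)) (u y :
  'I_n.+1) :
  fo (fun V E le r => touches_exactly E le (r m) (map (at2 r) cs) (r u) (r y)).
Proof.
apply: fo_and; last by apply: fo_not; apply: fo_touches_outside.
apply: (@fo_ext _ (fun V E le r =>
  all (fun c => ~~ le (r c.1) (r c.2) ||
    touches E le (r m) (at2 r c) (r u) (r y)) cs)).
  by apply: fo_all_seq => c; do ?[exact: fo_touches | fo_step].
by move=> V E le e; rewrite all_map.
Qed.

Lemma fo_jump_candidate n (m p h : 'I_n.+1) (cs : seq ('I_n.+1 * 'I_n.+1))
    (c y : 'I_n.+1) :
  fo (fun V E le r =>
    jump_candidate E le (r m) (r p) (r h) (map (at2 r) cs) (r c) (r y)).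
Proof.
apply: (@fo_ex _ (fun V E le r => [exists w,
  [&& nonconst le E (r ord0) (r (shift p)) (r (shift h)),
   nonconst le E w (r (shift p)) (r (shift h)), le (r (shift c)) (r ord0), le
     (r ord0) w,
   le w (r (shift y)),
   touches_exactly E le (r (shift m)) (map (at2 r) (map (@shift2 _) cs)) (r
     ord0) w
   & touches_outside E le (r (shift m)) (map (at2 r) (map (@shift2 _) cs)) (r
     ord0) (r (shift y))]])).
  apply: (@fo_ex _ (fun V E le r =>
    [&& nonconst le E (r (shift ord0)) (r (shift (shift p))) (r (shift (shift
      h))),
     nonconst le E (r ord0) (r (shift (shift p))) (r (shift (shift h))),
     le (r (shift (shift c))) (r (shift ord0)), le (r (shift ord0)) (r ord0),
     le (r ord0) (r (shift (shift y))),
     touches_exactly E le (r (shift (shift m)))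
       (map (at2 r) (map (@shift2 _) (map (@shift2 _) cs))) (r (shift ord0)) (r
         ord0)
     & touches_outside E le (r (shift (shift m)))
         (map (at2 r) (map (@shift2 _) (map (@shift2 _) cs))) (r (shift ord0))
         (r (shift (shift y)))])).
    by do ?[exact: fo_nonconst | exact: fo_touches_exactly | exact:
      fo_touches_outside | fo_step].
  by move=> V E le e v; rewrite !tnth_shiftE.
by move=> V E le e v; rewrite !tnth_shiftE.
Qed.

Lemma fo_jump n (m p h : 'I_n.+1) (cs : seq ('I_n.+1 * 'I_n.+1))
    (c y : 'I_n.+1) :
  fo (fun V E le r =>
    jump E le (r m) (r p) (r h) (map (at2 r) cs) (r c) (r y)).
Proof.
apply: fo_and; first exact: fo_nonconst.
apply: fo_and; first exact: fo_jump_candidate.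
apply: (@fo_all _ (fun V E le r =>
  ~~ (nonconst le E (r ord0) (r (shift p)) (r (shift h)) &&
    jump_candidate E le (r (shift m)) (r (shift p)) (r (shift h)) (map (at2 r)
      (map (@shift2 _) cs))
      (r (shift c)) (r ord0)) || le (r (shift y)) (r ord0))).
  by do ?[exact: fo_nonconst | exact: fo_jump_candidate | fo_step].
by move=> V E le e v; rewrite !tnth_shiftE implybE.
Qed.

Lemma fo_reach n (m p h : 'I_n.+1) (es : seq ('I_n.+1 * 'I_n.+1))
    (c d : 'I_n.+1) :
  fo (fun V E le r =>
    reach E le (r m) (r p) (r h) (map (at2 r) es) (r c) (r d)).
Proof.
(* The induction is on the length, because under the quantifier the tail of the list is shifted into
   a larger context. *)
have [s] := ubnP (size es); elim: s => // s IH in n m p h es c d *.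
case: es => [_ |e es /ltnSE les] /=; first exact: fo_eq.
apply: fo_or; first by apply: fo_and; [exact: fo_le | exact: IH].
apply: fo_and; first by apply/fo_not/fo_le.
apply: (@fo_ex _ (fun V E le r =>
  jump E le (r (shift m)) (r (shift p)) (r (shift h)) (map (at2 r) (map
    (@shift2 _) es))
    (r (shift c)) (r ord0) &&
  reach E le (r (shift m)) (r (shift p)) (r (shift h)) (map (at2 r) (map
    (@shift2 _) es))
    (r ord0) (r (shift d)))).
  by apply: fo_and; [exact: fo_jump | apply: IH; rewrite size_map].
by move=> V E le t v; rewrite !tnth_shiftE.
Qed.

Lemma fo_first_split n (p h d : 'I_n.+1) :
  fo (fun V E le r => first_split E le (r p) (r h) (r d)).
Proof.
apply: fo_and; first exact: fo_nonconst.
apply: (@fo_all _ (fun V E le r =>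
  ~~ nonconst le E (r ord0) (r (shift p)) (r (shift h)) || le (r (shift d)) (r
    ord0))).
  by do ?[exact: fo_nonconst | fo_step].
by move=> V E le e v; rewrite !tnth_shiftE implybE.
Qed.

Definition at4 n (V : finType) (r : 'I_n -> V) (g : 'I_n * 'I_n * 'I_n * 'I_n)
  :=
  (r g.1.1.1, r g.1.1.2, r g.1.2, r g.2).

Lemma fo_row_ok n (x : 'I_n) (g : 'I_n * 'I_n * 'I_n * 'I_n) :
  fo (fun V E le r => row_ok E le (r x) (at4 r g)).
Proof.
case: g => [[[lo mid] hi] sg]; rewrite /row_ok /at4 /=.
apply: fo_and; last by do ?[exact: fo_nonconst | fo_step].
apply: (@fo_all _ (fun V E le r =>
  ~~ (le (r (shift lo)) (r ord0) && le (r ord0) (r (shift mid))) ||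
  (E (r (shift x)) (r ord0) && (r (shift sg) == r (shift lo))
   || ~~ E (r (shift x)) (r ord0) && ~~ (r (shift sg) == r (shift lo))))).
  by repeat fo_step.
move=> V E le e v; rewrite !tnth_shiftE implybE; congr (_ || _).
by case: (E _ _); case: (_ == _).
Qed.

Lemma fo_cell_pred n (m c p h : 'I_n.+1) (es : seq ('I_n.+1 * 'I_n.+1))
    (gs : seq ('I_n.+1 * 'I_n.+1 * 'I_n.+1 * 'I_n.+1)) (x : 'I_n.+1) :
  fo (fun V E le r => cell_pred E le (r m) (r c) (r p) (r h)
    (map (at2 r) es) (map (at4 r) gs) (r x)).
Proof.
apply: fo_or; first exact: fo_eq.
apply: fo_and.
  apply: (@fo_ext _ (fun V E le r => all (fun g => row_ok E le (r x) (at4 r g))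
    gs)).
    by apply: fo_all_seq => g; apply: fo_row_ok.
  by move=> V E le e; rewrite all_map.
apply: fo_or; first exact: fo_eq.
apply: fo_and; first exact: fo_nonconst.
pose cs := map (fun g : _ * _ * _ * _ => (g.1.1.1, g.1.2)) gs.
have csE (V : finType) (r : 'I_n.+1 -> V) :
    map (@ends V) (map (at4 r) gs) = map (at2 r) cs.
  by rewrite -!map_comp; apply: eq_map.
apply: (@fo_ex _ (fun V E le r => [exists d,
  [&& first_split E le (r (shift p)) (r (shift h)) (r ord0),
   reach E le (r (shift m)) (r (shift p)) (r (shift h)) (map (at2 r) (map
     (@shift2 _) es))
     (r ord0) d, le d (r (shift x))
   & ~~ touches_outside E le (r (shift m)) (map (at2 r) (map (@shift2 _) cs)) d
     (r (shift x))]])).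
  apply: (@fo_ex _ (fun V E le r =>
    [&& first_split E le (r (shift (shift p))) (r (shift (shift h))) (r (shift
      ord0)),
     reach E le (r (shift (shift m))) (r (shift (shift p))) (r (shift (shift
       h)))
       (map (at2 r) (map (@shift2 _) (map (@shift2 _) es))) (r (shift ord0)) (r
         ord0),
     le (r ord0) (r (shift (shift x)))
     & ~~ touches_outside E le (r (shift (shift m)))
         (map (at2 r) (map (@shift2 _) (map (@shift2 _) cs))) (r ord0)
         (r (shift (shift x)))])).
    by do ?[exact: fo_first_split | exact: fo_reach | exact: fo_touches_outside
      | fo_step].
  by move=> V E le e v; rewrite !tnth_shiftE.
by move=> V E le e v; rewrite !tnth_shiftE csE.
Qed.

End Definability.

(** * Contraction sequences *)

Section Contractions.

Lemma sym_twin_ordered_bounded (k : int) n (M : 'M[entry]_n) :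
  sym_twin_ordered k M -> red_bounded k M.
Proof. by case. Qed.

(** The map [f] is the quotient that identifies [j] with [i], and [lift j] chooses the
    representatives. *)
Lemma merge_index n (i j : 'I_n) : j = i.+1 :> nat ->
  exists f : 'I_n -> 'I_n.-1, forall o, lift j (f o) = if o == j then i else o.
Proof.
move=> ji; have neq_ji : j != i by rewrite -val_eqE /= ji; lia.
have [i' Ei _] := unlift_some neq_ji.
exists (fun o => odflt i' (unlift j o)) => o.
have [->|neq_oj] := eqVneq o j; first by rewrite unlift_none /= -Ei.
by rewrite eq_sym in neq_oj; have [o' Eo ->] := unlift_some neq_oj; rewrite /=
  -Eo.
Qed.

(** Monotonicity rests on [i] and [j] being consecutive; it is what keeps all parts intervals of the
    order. *)
Lemma merge_index_mono n (i j : 'I_n) (f : 'I_n -> 'I_n.-1) :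
  j = i.+1 :> nat -> (forall o, lift j (f o) = if o == j then i else o) ->
  forall o1 o2 : 'I_n, o1 <= o2 -> f o1 <= f o2.
Proof.
move=> ji fE o1 o2 le12; rewrite -(leq_bump2 j).
have val_f o : bump j (f o) = (if o == j then i else o) :> nat.
  by rewrite -(fE o).
rewrite !val_f.
have eqj (o : 'I_n) : (o == j) = (o == i.+1 :> nat) by rewrite -val_eqE /= ji.
by rewrite !eqj; do 2?case: eqP; lia.
Qed.

Lemma contract_colsE m n (i j : 'I_n) (f : 'I_n -> 'I_n.-1)
    (M : 'M[entry]_(m, n)) p q :
  (forall o, lift j (f o) = if o == j then i else o) ->
  contract_cols i j M p (f q) = red \/ contract_cols i j M p (f q) = M p q.
Proof.
move=> fE; rewrite /contract_cols !mxE fE.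
have [->|neq_qj] := eqVneq q j.
  by rewrite eqxx; case: eqVneq => [->|_]; [right | left].
by case: eqVneq => [->|_]; [case: eqVneq => _; [right | left] | right].
Qed.

(** If [pi] maps each vertex to its part, an entry that is not red is the value of [E] on a whole
    block of pairs. *)
Definition red_quotient (V : finType) (E : rel V) n (M : 'M[entry]_n)
    (pi : V -> 'I_n) : Prop :=
  forall x y, M (pi x) (pi y) = red \/ M (pi x) (pi y) = Some (E x y).

Lemma sym_contract_red_quotient (V : finType) (E : rel V) n (M : 'M[entry]_n) pi
    (i j : 'I_n) (f : 'I_n -> 'I_n.-1) :
  (forall o, lift j (f o) = if o == j then i else o) ->
  red_quotient E M pi -> red_quotient E (sym_contract i j M) (f \o pi).
Proof.
move=> fE blockM x y /=; rewrite /sym_contract.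
have [->|->] := contract_colsE (contract_rows i j M) (f (pi x)) (pi y) fE.
  by left.
rewrite /contract_rows mxE.
have [->|->] := contract_colsE M^T%R (pi y) (pi x) fE; first by left.
by rewrite mxE; apply: blockM.
Qed.

Definition monotone_parts (V : finType) (rk : V -> nat) n (pi : V -> 'I_n) :=
  forall x y, rk x <= rk y -> pi x <= pi y.

(** Contractions are carried out until some [prev h] and [h] first fall into one part; this happens
    at the latest in the matrix of size 1. The partition [pi1] is the one just after that
    contraction and [pi2] the one just before, so each part of [pi1] is covered by two parts of
    [pi2]. *)
Lemma first_merging_stage (k : int) (V : finType) (E : rel V) (rk : V -> nat)
    (L : {set V}) (prev : V -> V) n (M : 'M[entry]_n) (pi : V -> 'I_n) :
  sym_twin_ordered k M -> monotone_parts rk pi -> red_quotient E M pi ->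
  {in L, forall h, pi (prev h) != pi h} -> L != set0 ->
  exists n1 (M1 : 'M[entry]_n1) (pi1 : V -> 'I_n1) n2 (pi2 : V -> 'I_n2),
    [/\ monotone_parts rk pi1, monotone_parts rk pi2, red_quotient E M1 pi1,
        red_bounded k M1
      & [/\ exists2 h, h \in L & pi1 (prev h) = pi1 h,
            {in L, forall h, pi2 (prev h) != pi2 h}
          & forall c, exists o1 o2, forall x,
              pi1 x = c -> pi2 x = o1 \/ pi2 x = o2]].
Proof.
move=> + + + + /set0Pn [h0 Lh0]; move=> STO.
elim: STO pi => {n M} [M _|n M i j ji _ STO IH] pi mono_pi blockM sepL.
  by have /eqP[] := sepL _ Lh0; rewrite !ord1.
have [f fE] := merge_index ji.
have mono_f : monotone_parts rk (f \o pi).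
  by move=> x y le_xy; apply: (merge_index_mono ji fE); apply: mono_pi.
have blockf := sym_contract_red_quotient fE blockM.
have [sepf|] := boolP [forall h in L, (f \o pi) (prev h) != (f \o pi) h].
  by apply: IH mono_f blockf _ => h Lh; have /forall_inP := sepf; apply.
rewrite negb_forall => /existsP[h]; rewrite negb_imply negbK => /andP[Lh /eqP
  Eh].
exists n.-1, (sym_contract i j M), (f \o pi), n, pi; split; [exact: mono_f | by
  [] | exact: blockf | |].
  exact: sym_twin_ordered_bounded STO.
split=> //; first by exists h.
move=> c; exists (lift j c), j => x /= <-; rewrite fE.
by case: eqVneq => [->|_]; [right | left].
Qed.
End Contractions.

(** * Greedy runs and jumps *)

Section Runs.

Variables (V G : finType) (rk : V -> nat) (rk_inj : injective rk).
Variables (D : {set V}) (touched : V -> V -> {set G}) (K : nat).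
Hypothesis touched_mono : forall u' u y y', rk u' <= rk u -> rk y <= rk y' ->
  touched u y \subset touched u' y'.
Hypothesis touched_cat : forall u w y, rk u <= rk w <= rk y ->
  touched u y \subset touched u w :|: touched w y.

(** This and the next two definitions are counterparts of [jump_candidate], [jump] and [reach] for
    an abstract [touched], assumed monotone and subadditive. *)
Definition candidate (F : {set G}) (c y : V) : bool :=
  [exists u in D, exists w in D,
    [&& rk c <= rk u, rk u <= rk w, rk w <= rk y, touched u w == F & ~~
      (touched u y \subset F)]].

Definition jump_to (F : {set G}) (c y : V) : Prop :=
  [/\ y \in D, candidate F c y & forall y', y' \in D -> candidate F c y' -> rk
    y <= rk y'].

Fixpoint jumps_to (Fs : seq {set G}) (c d : V) : Prop :=
  if Fs is F :: Fs' then exists2 c', jump_to F c c' & jumps_to Fs' c' d else c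
    = d.

Lemma jump_to_fun F c y1 y2 : jump_to F c y1 -> jump_to F c y2 -> y1 = y2.
Proof.
case=> D1 h1 m1 [D2 h2 m2]; apply: rk_inj; apply/eqP.
by rewrite eqn_leq m1 // m2.
Qed.

Lemma jumps_to_fun Fs c d1 d2 : jumps_to Fs c d1 -> jumps_to Fs c d2 -> d1 = d2.
Proof.
elim: Fs c => [|F Fs IH] c /=; first by move=> <- <-.
case=> c1 j1 r1 [c2 j2 r2]; rewrite (jump_to_fun j2 j1) in r2.
exact: IH r1 r2.
Qed.

Lemma jumps_to_cat Fs Gs c d e :
  jumps_to Fs c d -> jumps_to Gs d e -> jumps_to (Fs ++ Gs) c e.
Proof.
elim: Fs c => [|F Fs IH] c /=; first by move=> ->.
by case=> c' j r r2; exists c' => //; apply: IH.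
Qed.

Lemma jump_to_ex F c y : y \in D -> candidate F c y ->
  exists2 y', jump_to F c y' & rk y' <= rk y.
Proof.
move=> Dy hy.
case: (@arg_minnP _ y (fun z => (z \in D) && candidate F c z) rk) => [|z
  /andP[Dz hz] mz].
  by rewrite Dy.
exists z; first by split=> // y' Dy' hy'; apply: mz; rewrite Dy'.
by apply: mz; rewrite Dy.
Qed.

Lemma candidateP F c y : reflect (exists u w, [/\ u \in D, w \in D,
    rk c <= rk u <= rk w, rk w <= rk y & touched u w = F /\ ~~ (touched u y
      \subset F)])
  (candidate F c y).
Proof.
apply: (iffP idP).
  case/exists_inP=> u Du /exists_inP[w Dw] /and5P[h1 h2 h3 /eqP h4 h5].
  by exists u, w; rewrite h1 h2.
case=> u [w] [Du Dw /andP[h1 h2] h3 [h4 h5]].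
by apply/exists_inP; exists u => //; apply/exists_inP; exists w; rewrite // h1
  h2 h3 h4 eqxx.
Qed.

(* A greedy decomposition of [D], listed by the first elements of its runs: a
   run is continued as long as at most [K] cells are touched. *)
Fixpoint runs (c : V) (ds : seq V) : Prop :=
  if ds is d :: ds' then
    [/\ d \in D, rk c <= rk d, K < #|touched c d|,
      forall x, x \in D -> rk c <= rk x < rk d -> #|touched c x| <= K & runs d
        ds']
  else forall x, x \in D -> rk c <= rk x -> #|touched c x| <= K.

(** Rows of one part touch at most [K] cells, so a run that is cut at [d] began in an earlier part
    than that of [d]. Hence every new run uses up a part, and there are at most as many runs as
    parts met by [D]. *)
Lemma runs_ex (m : nat) (part : V -> 'I_m) :
  (forall x y, rk x <= rk y -> part x <= part y) ->
  (forall x y, rk x <= rk y -> part x = part y -> #|touched x y| <= K) ->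
  forall c, c \in D -> exists2 ds, runs c ds &
    size ds < #|[set part x | x in [set x in D | rk c <= rk x]]|.
Proof.
move=> mono_part small c.
have [s] := ubnP (\max_x (rk x) - rk c); elim: s c => // s IH c le_s Dc.
pose P := [set part x | x in [set x in D | rk c <= rk x]].
have Pc : part c \in P by apply: imset_f; rewrite inE Dc leqnn.
have [/exists_inP[y Dy /andP[le_cy big_y]]|] :=
  boolP [exists y in D, (rk c <= rk y) && (K < #|touched c y|)]; last first.
  move=> noy; exists [::]; last by apply/card_gt0P; exists (part c).
  move=> x Dx le_cx; rewrite leqNgt; apply: contraNN noy => big_x.
  by apply/exists_inP; exists x; rewrite ?le_cx.
case: (@arg_minnP _ y (fun z => [&& z \in D, rk c <= rk z & K < #|touched c
  z|]) rk).
  by rewrite Dy le_cy.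
move=> d /and3P[Dd le_cd big_d] min_d.
have neq_part : part c != part d.
  by apply: contraTneq big_d => /(small _ _ le_cd); rewrite -leqNgt.
have lt_cd : rk c < rk d.
  rewrite ltn_neqAle le_cd andbT; apply: contra neq_part.
  by move/eqP/rk_inj => ->.
have [|//|ds runs_d size_d] := IH d.
  by have := @leq_bigmax V rk d; lia.
exists (d :: ds).
  split=> // x Dx /andP[le_cx lt_xd]; rewrite leqNgt; apply/negP => big_x.
  by have := min_d x; rewrite Dx le_cx big_x leqNgt lt_xd => /(_ isT).
rewrite /= -/P; apply: (leq_ltn_trans size_d); apply: proper_card.
apply/properP; split.
  apply/subsetP => _ /imsetP[x + ->]; rewrite inE => /andP[Dx le_dx].
  by apply: imset_f; rewrite inE Dx (leq_trans le_cd).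
exists (part c) => //; apply: contra neq_part => /imsetP[x + Ec].
rewrite inE => /andP[Dx le_dx]; rewrite -val_eqE eqn_leq /= mono_part //.
by rewrite Ec mono_part.
Qed.

Definition start (c : V) ds i := nth c (c :: ds) i.

Definition inrun c ds i x :=
  [&& x \in D, rk (start c ds i) <= rk x &
      (i < size ds) ==> (rk x < rk (start c ds i.+1))].

Lemma start_cons c d ds i : i <= size ds -> start c (d :: ds) i.+1 = start d ds
  i.
Proof. by move=> lti; rewrite /start; apply: set_nth_default. Qed.

Lemma inrun_cons c d ds i x : i <= size ds ->
  inrun c (d :: ds) i.+1 x = inrun d ds i x.
Proof.
move=> lei; rewrite /inrun start_cons //= ltnS; congr [&& _, _ & _].
by case: (ltnP i (size ds)) => //= lti; rewrite start_cons.
Qed.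

Lemma runsP c ds : c \in D -> runs c ds ->
  [/\ forall i, i <= size ds -> start c ds i \in D,
      forall i, i < size ds -> K < #|touched (start c ds i) (start c ds i.+1)|,
      forall i, i < size ds -> rk (start c ds i) <= rk (start c ds i.+1)
    & forall i x, i <= size ds -> inrun c ds i x -> #|touched (start c ds i) x|
      <= K].
Proof.
elim: ds c => [|d ds IH] c Dc.
  move=> small; split=> [[|]||| [|i] x] //= _ /and3P[Dx le_cx _]; exact: small.
case=> Dd le_cd big_d small /(IH d Dd) [h1 h2 h3 h4].
split=> [[|i] lti|[|i] lti|[|i] lti|[|i] x lti] //=.
- by rewrite start_cons ?h1.
- by rewrite !start_cons ?h2 // ltnW.
- by rewrite !start_cons ?h3 // ltnW.
- by case/and3P=> Dx le_cx lt_xd; apply: small; rewrite // le_cx.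
by rewrite start_cons // inrun_cons //; apply: h4.
Qed.

(** * Reaching the start of a run by jumps *)

Section Location.

Variables (c : V) (ds : seq V).
Hypotheses (Dc : c \in D) (c_min : forall x, x \in D -> rk c <= rk x)
  (runs_ds : runs c ds).

Let st := start c ds.
Let m := size ds.

Lemma start_inD i : i <= m -> st i \in D.
Proof. by have [h _ _ _] := runsP Dc runs_ds; apply: h. Qed.

Lemma start_big i : i < m -> K < #|touched (st i) (st i.+1)|.
Proof. by have [_ h _ _] := runsP Dc runs_ds; apply: h. Qed.

Lemma run_small i x : i <= m -> inrun c ds i x -> #|touched (st i) x| <= K.
Proof. by have [_ _ _ h] := runsP Dc runs_ds; apply: h. Qed.

Lemma start_le i j : i <= j -> j <= m -> rk (st i) <= rk (st j).
Proof.
have [_ _ h _] := runsP Dc runs_ds.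
elim: j => [|j IH]; first by rewrite leqn0 => /eqP ->.
rewrite leq_eqVlt => /predU1P[-> //|]; rewrite ltnS => leij ltj.
by apply: leq_trans (IH leij (ltnW ltj)) _; apply: h.
Qed.

Hypothesis touched_refl : forall x, touched x x = set0.

Lemma start_lt i : i < m -> rk (st i) < rk (st i.+1).
Proof.
move=> lti; rewrite ltn_neqAle start_le // andbT.
by apply: contraTneq (start_big lti) => /rk_inj ->; rewrite touched_refl cards0.
Qed.

Lemma inrun_start i : i <= m -> inrun c ds i (st i).
Proof.
by move=> lei; apply/and3P; split; rewrite ?start_inD //; apply/implyP/start_lt.
Qed.

Lemma inrun_ex x : x \in D -> exists2 i, i <= m & inrun c ds i x.
Proof.
move=> Dx.
have exi : exists i, (i <= m) && (rk (st i) <= rk x) by exists 0; rewrite /=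
  c_min.
have bnd i : (i <= m) && (rk (st i) <= rk x) -> i <= m by case/andP.
case: (ex_maxnP exi bnd) => i /andP[lei le_x] max_i.
exists i => //; apply/and3P; split=> //; apply/implyP => lti; rewrite ltnNge.
by apply/negP => le_x1; have := max_i i.+1; rewrite lti le_x1 ltnn => /(_ isT).
Qed.

Definition run_last i := [arg max_(x > st i | inrun c ds i x) rk x].
(** By monotonicity this set contains every cell touched between two elements of the run. *)
Definition run_cells i := touched (st i) (run_last i).

Lemma run_lastP i : i <= m -> inrun c ds i (run_last i) /\
  forall x, inrun c ds i x -> rk x <= rk (run_last i).
Proof.
move=> lei; rewrite /run_last.
by case: arg_maxnP => [|e re maxe]; [exact: inrun_start | split].
Qed.

Lemma card_run_cells i : i <= m -> #|run_cells i| <= K.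
Proof. by move=> lei; apply: run_small => //; case: (run_lastP lei). Qed.

Lemma run_cells_max i u y : i <= m -> rk (st i) <= rk u -> inrun c ds i y ->
  touched u y \subset run_cells i.
Proof.
by move=> lei le_u ry; apply: touched_mono => //; case: (run_lastP lei) => _;
  apply.
Qed.

Lemma run_cells_next i : i < m -> ~~ (touched (st i) (st i.+1) \subset
  run_cells i).
Proof.
move=> lti; apply: contraTN (start_big lti) => /subset_leq_card.
by rewrite -leqNgt => /leq_trans; apply; apply: card_run_cells; apply: ltnW.
Qed.

(** Reaching the next start touches more than [K] cells, hence one outside the at most [K] cells of
    the run. So a run is described by its first element and its cells alone. *)
Lemma inrunE j x : j <= m -> inrun c ds j x =
  [&& x \in D, rk (st j) <= rk x & touched (st j) x \subset run_cells j].
Proof.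
move=> lej; apply/idP/and3P => [rx|[Dx le_x sub_x]].
  by case/and3P: (rx) => ? ? _; split=> //; apply: run_cells_max.
apply/and3P; split=> //; apply/implyP => ltj; rewrite ltnNge; apply/negP =>
  le_jx.
case/negP: (run_cells_next ltj); apply: subset_trans sub_x.
exact: touched_mono.
Qed.

(** Let [R] be the set of cells of run [j]. An [R]-jump from a point not after [st j] lands at
    [st j.+1] or not after [st j]. In the latter case it has left the run in which it began, since a
    run containing the whole jump interval would have a set of cells properly containing [R]. So
    each jump reaches a later run, and at most [j.+1 - t] jumps are made. *)
Lemma repeated_jumps j t0 : j < m -> t0 <= j ->
  (forall t, t0 <= t < j -> ~~ (run_cells j \proper run_cells t)) ->
  forall y t, t0 <= t <= j -> inrun c ds t y -> rk y <= rk (st j) ->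
  exists2 n, n <= j.+1 - t & jumps_to (nseq n (run_cells j)) y (st j.+1).
Proof.
move=> ltj let0 no_sup; set R := run_cells j.
have not_sup t : t0 <= t <= j -> ~~ (R \proper run_cells t).
  case/andP=> le0; rewrite leq_eqVlt => /predU1P[->|ltt]; first by rewrite
    properxx.
  by apply: no_sup; rewrite le0.
have lej := ltnW ltj.
move=> y t; have [s] := ubnP (j - t); elim: s => // s IH in y t *.
move=> le_s /andP[le_t0 le_tj] ry le_yj.
have lem : t <= m by apply: leq_trans le_tj lej.
(* The interval from [st j] to the last element of run [j] touches exactly [R], and its extension to
   [st j.+1] touches more; so [st j.+1] is a candidate. *)
have [y1 jy1 le_y1] : exists2 y1, jump_to R y y1 & rk y1 <= rk (st j.+1).
  apply: jump_to_ex; first exact: start_inD.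
  have [/and3P[De le_e _] _] := run_lastP lej.
  apply/candidateP; exists (st j), (run_last j); split=> //.
  - exact: start_inD.
  - by rewrite le_yj le_e.
  - have [/and3P[_ _ /implyP h] _] := run_lastP lej; exact/ltnW/h.
  by split=> //; apply: run_cells_next.
have [Dy1 hy1 min_y1] := jy1.
have [/rk_inj ey1|neq_y1] := eqVneq (rk y1) (rk (st j.+1)).
  rewrite ey1 in jy1; exists 1; last by exists (st j.+1).
  by rewrite subn_gt0 ltnS.
have lt_y1 : rk y1 < rk (st j.+1) by rewrite ltn_neqAle neq_y1.
have /candidateP[u [w [Du Dw /andP[le_yu le_uw] le_wy1 [ctuw ncty1]]]] := hy1.
have [i lei ry1] := inrun_ex Dy1.
have /and3P[_ le_iy1 /implyP lt_iy1] := ry1.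
have lt_iS k1 : rk (st k1) <= rk y1 -> k1 <= m -> k1 <= i.
  move=> le_k1 lek1; rewrite leqNgt; apply/negP => lt_ik1.
  have /lt_iy1 : i < size ds by apply: leq_trans lt_ik1 lek1.
  by rewrite ltnNge; apply/negP; rewrite negbK (leq_trans _ le_k1) ?start_le.
have le_ij : i <= j.
  rewrite leqNgt; apply/negP => lt_ji.
  by move: lt_y1; rewrite ltnNge (leq_trans (start_le lt_ji lei)).
have [/and3P[_ le_ty /implyP lt_ty]] := ry.
have le_ti : t <= i.
  by apply: lt_iS => //; rewrite (leq_trans le_ty) // (leq_trans le_yu)
    ?(leq_trans le_uw).
(* A jump cannot land inside run [j]. *)
have le_y1j : rk y1 <= rk (st j).
  rewrite leqNgt; apply/negP => lt_jy1.
  have ry1j : inrun c ds j y1.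
    by apply/and3P; split=> //; [exact: ltnW | exact/implyP].
  case/negP: ncty1; have [le_ju|/ltnW le_uj] := leqP (rk (st j)) (rk u).
    exact: run_cells_max.
  have sub_uj : touched u (st j) \subset R.
    apply: contraTT lt_jy1 => nsub; rewrite -leqNgt; apply: min_y1.
      exact: start_inD.
    have [le_wj|/ltnW le_jw] := leqP (rk w) (rk (st j)).
      by apply/candidateP; exists u, w; rewrite le_yu le_uw.
    by case/negP: nsub; rewrite -ctuw; apply: touched_mono.
  apply: subset_trans (touched_cat (w := st j) _) _; first by rewrite le_uj
    ltnW.
  by rewrite subUset sub_uj run_cells_max.
(* If the jump ended in run [t], the cells touched from [u] to [y1] would all belong to run [t];
   they include [R] and a cell outside [R]. *)
have lt_ti : t < i.
  rewrite ltn_neqAle le_ti andbT; apply/eqP => eti.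
  have sub_t : touched u y1 \subset run_cells t.
    by apply: run_cells_max; rewrite ?eti // -eti (leq_trans le_ty).
  have /negP[] : ~~ (R \proper run_cells t) by apply: not_sup; rewrite le_t0.
  apply/properP; split.
    by apply: subset_trans sub_t; rewrite -ctuw; apply: touched_mono.
  case/subsetPn: ncty1 => g gin gnin; exists g => //.
  exact: (subsetP sub_t).
have [||//|//|n le_n jn] := IH y1 i.
- by lia.
- by rewrite le_ij (leq_trans le_t0).
by exists n.+1; [lia | exists y1].
Qed.

(** Let [i] be the last run before run [j] whose cells properly contain those of [j]. The start of
    run [i.+1] is reached by induction, with sets that all contain the cells of run [i]; jumps for
    the cells of run [j] then lead past run [j]. The clause on [run_cells j.-1], the last run
    passed, is what makes the concatenated chain decreasing. *)
Lemma start_reachable j : j <= m -> exists Fs : seq {set G},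
  [/\ sorted (fun A B : {set G} => B \subset A) Fs,
      size Fs <= j, (forall F, F \in Fs -> (exists2 i, i <= m & F = run_cells
        i) /\
        (0 < j -> run_cells j.-1 \subset F))
    & jumps_to Fs (st 0) (st j)].
Proof.
have [s] := ubnP j; elim: s j => // s IH [|j] /ltnSE le_s lej; first by exists
  [::].
(* The run [t0] is where the repeated jumps begin: [i.+1] for the last run [i] with a properly
   larger set, or 0 if there is none. *)
have extend t0 : t0 <= j -> (forall t, t0 <= t < j -> ~~ (run_cells j \proper
  run_cells t)) ->
    (0 < t0 -> run_cells j \subset run_cells t0.-1) ->
    exists Fs : seq {set G},
  [/\ sorted (fun A B : {set G} => B \subset A) Fs,
      size Fs <= j.+1, (forall F, F \in Fs -> (exists2 i, i <= m & F =
        run_cells i) /\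
        (0 < j.+1 -> run_cells j.+1.-1 \subset F))
    & jumps_to Fs (st 0) (st j.+1)].
  move=> let0 no_sup sub_t0.
  have let0m : t0 <= m by apply: leq_trans (ltnW lej).
  have [|//|Fs [sorted_Fs size_Fs Fs_ok jFs]] := IH t0; first by lia.
  have [|||n le_n jn] := repeated_jumps lej let0 no_sup (y := st t0) (t := t0).
  - by rewrite leqnn.
  - exact: inrun_start.
  - by apply: start_le => //; apply: ltnW.
  have sub_R F : F \in Fs -> run_cells j \subset F.
    move=> FFs; have [_ sub] := Fs_ok F FFs.
    case: (posnP t0) => [t00|t0gt]; last exact: subset_trans (sub_t0 t0gt) (sub
      t0gt).
    by move: size_Fs; rewrite t00 leqn0 => /nilP Fs0; rewrite Fs0 in FFs.
  exists (Fs ++ nseq n (run_cells j)); split.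
  - have sup_tr : transitive (fun A B : {set G} => B \subset A).
      by move=> A B C h1 h2; apply: subset_trans h2 h1.
    rewrite sorted_pairwise // pairwise_cat -sorted_pairwise // sorted_Fs /=.
    apply/andP; split.
      apply/allrelP => F F' FFs; rewrite mem_nseq => /andP[_ /eqP ->].
      exact: sub_R.
    by elim: (n) => //= n' ->; rewrite andbT all_nseq subxx orbT.
  - by rewrite size_cat size_nseq; lia.
  - move=> F; rewrite mem_cat mem_nseq => /orP[FFs|/andP[_ /eqP ->]].
      by have [leK _] := Fs_ok F FFs; split=> // _; apply: sub_R.
    by split=> //; exists j => //; apply: ltnW.
  exact: jumps_to_cat jFs jn.
pose P i := (i < j) && (run_cells j \proper run_cells i).
have [/existsP[i0 Pi0]|noP] := boolP [exists i : 'I_j, P i].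
  have bnd i : P i -> i <= j by case/andP=> /ltnW.
  have exP : exists i, P i by exists i0.
  case: (ex_maxnP exP bnd) => i /andP[ltij sub_i] max_i.
  have [|t /andP[lt_it ltj]||Fs H] := extend i.+1 => //; last 2 first.
  - by move=> _; apply: proper_sub.
  - exact: (ex_intro _ Fs H).
  by apply: contraTN lt_it => sub_t; rewrite -leqNgt; apply: max_i; rewrite /P
    ltj.
have [|t /andP[_ ltj]||Fs H] := extend 0 => //; last exact: (ex_intro _ Fs H).
apply: contra noP => sub_t; apply/existsP; exists (Ordinal ltj).
by rewrite /P ltj.
Qed.

End Location.
End Runs.

(** * Cells of columns *)

Lemma nonconstP (V : finType) (le F : rel V) x a b :
  reflect (exists z z', [/\ le a z && le z b, le a z' && le z' b, F x z
    & ~~ F x z']) (nonconst le F x a b).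
Proof.
apply: (iffP existsP) => [[z /existsP[z' /and5P[h1 h2 h3 h4 /andP[h5 h6]]]]|].
  by exists z, z'; rewrite h1 h2 h3 h4.
case=> z [z' [/andP[h1 h2] /andP[h3 h4] h5 h6]]; exists z; apply/existsP.
by exists z'; rewrite h1 h2 h3 h4 h5.
Qed.

Lemma nonconstPn (V : finType) (le F : rel V) x a b z z' : ~~ nonconst le F x a
  b ->
  le a z && le z b -> le a z' && le z' b -> F x z = F x z'.
Proof.
move=> nF hz hz'; apply/idP/idP => [Fz|Fz']; apply: contraNT nF => nFz.
  by apply/nonconstP; exists z, z'.
by apply/nonconstP; exists z', z.
Qed.

Section Cells.

Variables (V : finType) (E le : rel V) (rk : V -> nat).
Hypotheses (rk_inj : injective rk) (leE : forall x y, le x y = (rk x <= rk y)).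
Variables (S : {set V}) (m0 : V).
Hypotheses (Sm0 : m0 \in S) (m0_min : forall s, s \in S -> rk m0 <= rk s).

Definition prev h := [arg max_(s > m0 | (s \in S) && (rk s < rk h)) rk s].

Lemma prevP h : h \in S -> h != m0 -> [/\ prev h \in S, rk (prev h) < rk h
  & forall s, s \in S -> rk s < rk h -> rk s <= rk (prev h)].
Proof.
move=> Sh neq_h; rewrite /prev.
have lt_m0 : rk m0 < rk h.
  by rewrite ltn_neqAle m0_min // andbT; apply: contra neq_h => /eqP/rk_inj ->.
case: arg_maxnP => [|s /andP[Ss lt_s] max_s]; first by rewrite Sm0.
by split=> // s' Ss' lt_s'; apply: max_s; rewrite Ss'.
Qed.

(** A break is named by its right end. *)
Definition breaks x := [set h in S | (h != m0) && nonconst le E x (prev h) h].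

Variable L : {set V}.
Hypothesis L_S : L \subset S :\ m0.

Lemma L_prevP h : h \in L -> [/\ h \in S, h != m0, prev h \in S, rk (prev h) <
  rk h
  & forall s, s \in S -> rk s < rk h -> rk s <= rk (prev h)].
Proof.
move=> /(subsetP L_S); rewrite in_setD1 => /andP[neq_h Sh].
by have [] := prevP Sh neq_h.
Qed.

(** A cell begins at the right end of a break, or at [m0], and is named by its first column; thus
    the next break lies at the end of the cell. *)
Definition heads := m0 |: L.

Lemma heads_S g : g \in heads -> g \in S.
Proof. by case/setU1P=> [->|/L_prevP[]]. Qed.

Definition cellof z := [arg max_(g > m0 | (g \in heads) && (rk g <= rk z)) rk
  g].

Lemma cellofP z : rk m0 <= rk z -> [/\ cellof z \in heads, rk (cellof z) <= rk z
  & forall g, g \in heads -> rk g <= rk z -> rk g <= rk (cellof z)].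
Proof.
move=> le_z; rewrite /cellof; case: arg_maxnP => [|g /andP[Hg le_g] max_g].
  by rewrite setU11.
by split=> // g' Hg' le_g'; apply: max_g; rewrite Hg'.
Qed.

Lemma cellof_mono z1 z2 : rk m0 <= rk z1 -> rk z1 <= rk z2 ->
  rk (cellof z1) <= rk (cellof z2).
Proof.
move=> le1 le12; have [H1 le_1 _] := cellofP le1.
have [_ _ max2] := cellofP (leq_trans le1 le12).
by apply: max2 => //; apply: leq_trans le12.
Qed.

Lemma splitsP z u y : reflect (exists w w', [/\ rk u <= rk w <= rk y,
    rk u <= rk w' <= rk y, E w z & ~~ E w' z]) (splits E le z u y).
Proof.
by apply: (iffP (nonconstP _ _ _ _ _)) => -[w [w' H]]; exists w, w'; rewrite
  !leE in H *.
Qed.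

Definition touched u y :=
  [set cellof z | z in [set z | (rk m0 <= rk z) && splits E le z u y]].

Lemma touchedP u y g : reflect (exists z, [/\ rk m0 <= rk z, splits E le z u y
  & cellof z = g]) (g \in touched u y).
Proof.
apply: (iffP imsetP) => [[z + ->]|[z [h1 h2 <-]]].
  by rewrite inE => /andP[h1 h2]; exists z.
by exists z; rewrite // inE h1.
Qed.

Lemma touched_mono u' u y y' : rk u' <= rk u -> rk y <= rk y' ->
  touched u y \subset touched u' y'.
Proof using leE.
move=> leu ley; apply/subsetP => g /touchedP[z [mz /splitsP[w [w' [hw hw' Ew
  nEw']]] <-]].
have widen v : rk u <= rk v <= rk y -> rk u' <= rk v <= rk y'.
  by case/andP=> h1 h2; rewrite (leq_trans leu h1) (leq_trans h2 ley).
by apply/touchedP; exists z; split=> //; apply/splitsP; exists w, w'; split=>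
  //; apply: widen.
Qed.

Lemma touched_refl x : touched x x = set0.
Proof using rk_inj leE.
apply/setP => g; rewrite inE; apply/negP => /touchedP[z [_ /splitsP[w [w' [hw
  hw' Ew]]]]].
have eq_x v : rk x <= rk v <= rk x -> v = x.
  by move=> hv; apply: rk_inj; apply/eqP; rewrite eqn_leq andbC.
by rewrite (eq_x w') // -(eq_x w) // Ew.
Qed.

(** A column with two values between [u] and [y] differs at one of the two rows from its value at
    [w], hence is split on that side of [w]. *)
Lemma touched_cat u w y : rk u <= rk w <= rk y -> touched u y \subset touched u
  w :|: touched w y.
Proof using leE.
move=> hw; apply/subsetP => g /touchedP[z [mz /splitsP[w1 [w2 [h1 h2 E1 E2]]]
  <-]].
have sideP v : rk u <= rk v <= rk y -> E v z != E w z -> cellof z \in touched u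
  w :|: touched w y.
  move=> hv neq; have cr a b : rk a <= rk v <= rk b -> rk a <= rk w <= rk b ->
      splits E le z a b.
    move=> hav haw; apply/splitsP; case: (boolP (E v z)) neq => Ev neq.
      by exists v, w; split=> //; move: neq; case: (E w z).
    by exists w, v; split=> //; move: neq; case: (E w z).
  case/andP: hv => le_uv le_vy; case/andP: hw => le_uw le_wy.
  apply/setUP; have [le_vw|/ltnW le_wv] := leqP (rk v) (rk w); [left|right];
    apply/touchedP; exists z; split=> //; apply: cr.
  - by rewrite le_uv.
  - by rewrite le_uw leqnn.
  - by rewrite le_wv.
  by rewrite leqnn.
have [e1|] := eqVneq (E w1 z) (E w z); last exact: sideP.
by apply: (sideP w2); rewrite // -e1 E1 (negbTE E2).
Qed.

Lemma touched_heads u y : touched u y \subset heads.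
Proof. by apply/subsetP => g /touchedP[z [mz _ <-]]; case: (cellofP mz). Qed.

Lemma touched_const d x z : rk d <= rk x -> rk m0 <= rk z -> cellof z \notin
  touched d x ->
  E x z = E d z.
Proof.
move=> le_dx mz nct; apply/eqP; apply: contraNT nct => neq.
apply/touchedP; exists z; split=> //; apply/splitsP.
case Edz: (E d z) neq => neq; [exists d, x | exists x, d];
  by rewrite Edz le_dx !leqnn; split=> //; move: neq; case: (E x z).
Qed.

(** The next head after [g] is [hi], and [mid] is the element of [S] before it, where the final gap
    begins. For the last cell, [hi = g] codes the missing upper end and [mid] is the last element of
    [S]. *)
Lemma cell_bounds g : g \in heads -> exists mid hi,
  [/\ mid \in S, hi \in S, rk g <= rk mid, rk g <= rk hi
    & (forall z, rk m0 <= rk z -> incell le (g, hi) z = (cellof z == g)) /\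
      ((hi = g /\ forall s, s \in S -> rk s <= rk mid) \/
       [/\ hi \in L, prev hi = mid & rk g < rk hi])].
Proof.
move=> Hg; have Sg := heads_S Hg.
have [/exists_inP[l Ll lt_gl]|noL] := boolP [exists l in L, rk g < rk l].
  case: (@arg_minnP _ l (fun h => (h \in L) && (rk g < rk h)) rk) => [|h].
    by rewrite Ll.
  move=> /andP[Lh lt_gh] min_h; have [Sh neq_h Sp lt_p max_p] := L_prevP Lh.
  exists (prev h), h; split=> //; [exact: max_p | exact: ltnW |].
  split=> [z mz|]; last by right.
  have [Hc le_c max_c] := cellofP mz.
  have neq_hg : h != g by apply: contraTneq lt_gh => ->; rewrite ltnn.
  rewrite /incell /= !leE (negbTE neq_hg) orbF -ltnNge.
  apply/andP/eqP => [[le_gz lt_zh]|ecz].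
    apply: rk_inj; apply/eqP; rewrite eqn_leq max_c // andbT leqNgt.
    apply/negP => lt_gc; have Lc : cellof z \in L.
      case/setU1P: Hc => // ec; move: lt_gc.
      by rewrite ec ltnNge m0_min.
    have := min_h (cellof z); rewrite Lc lt_gc => /(_ isT) le_h.
    by move: lt_zh; rewrite ltnNge (leq_trans le_h).
  rewrite -ecz; split=> //; rewrite ltnNge; apply/negP => le_hz.
  have := max_c h; rewrite inE Lh orbT ecz => /(_ isT le_hz).
  by rewrite leqNgt lt_gh.
case: (@arg_maxnP _ m0 (fun s => s \in S) rk) => // mid Smid max_mid.
exists mid, g; split=> //; first exact: max_mid.
split=> [z mz|]; last by left.
have [Hc le_c max_c] := cellofP mz.
rewrite /incell /= leE eqxx orbT andbT; apply/idP/eqP => [le_gz|<- //].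
apply: rk_inj; apply/eqP; rewrite eqn_leq max_c // andbT leqNgt.
apply: contra noL => lt_gc; apply/exists_inP; exists (cellof z) => //.
by case/setU1P: Hc => // ec; move: lt_gc; rewrite ec ltnNge m0_min.
Qed.

(* If [z1 <= z <= z3] lie in three different cells, then the break at the head
   of the last of them lies between [z1] and [z3]. *)
Lemma card_cells_part n (pi : V -> 'I_n) (o : 'I_n) :
  monotone_parts rk pi -> {in L, forall h, pi (prev h) != pi h} ->
  #|[set cellof z | z in [set z | (rk m0 <= rk z) && (pi z == o)]]| <= 2.
Proof.
move=> mono_pi sepL; set Z := [set z | _].
have [->|/set0Pn[z0 Zz0]] := eqVneq Z set0; first by rewrite imset0 cards0.
case: (@arg_minnP _ z0 (fun z => z \in Z) rk) => // z1 Zz1 min1.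
case: (@arg_maxnP _ z0 (fun z => z \in Z) rk) => // z3 Zz3 max3.
suff sub : [set cellof z | z in Z] \subset [set cellof z1; cellof z3].
  by apply: leq_trans (subset_leq_card sub) _; rewrite cards2; case: eqP.
apply/subsetP => _ /imsetP[z Zz ->]; rewrite !inE.
have ZP w : w \in Z -> rk m0 <= rk w /\ pi w = o by rewrite inE => /andP[?
  /eqP].
have [[[mz1 pz1] [mz pz]] [mz3 pz3]] := (ZP _ Zz1, ZP _ Zz, ZP _ Zz3).
rewrite -[_ || _]negbK negb_or; apply/negP => /andP[neq1 neq3].
have lt1 : rk (cellof z1) < rk (cellof z).
  rewrite ltn_neqAle (cellof_mono mz1 (min1 _ Zz)) andbT.
  by apply: contra neq1 => /eqP/rk_inj ->; rewrite eqxx.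
have lt3 : rk (cellof z) < rk (cellof z3).
  rewrite ltn_neqAle (cellof_mono mz (max3 _ Zz)) andbT.
  by apply: contra neq3 => /eqP/rk_inj ->; rewrite eqxx.
have [[[H1 le1 M1] [H2 le2 M2]] [H3 le3 M3]] :=
  (cellofP mz1, cellofP mz, cellofP mz3).
have L3 : cellof z3 \in L.
  by case/setU1P: H3 => // e3; move: lt3; rewrite e3 ltnNge m0_min // heads_S.
have [_ _ _ lt_p max_p] := L_prevP L3.
have le_p := max_p _ (heads_S H2) lt3.
have lt_z1 : rk z1 < rk (cellof z).
  by rewrite ltnNge; apply: contraTN lt1 => /(M1 _ H2); rewrite -leqNgt.
case/negP: (sepL _ L3); rewrite -val_eqE /= eqn_leq mono_pi ?(ltnW lt_p) //=.
apply: leq_trans (mono_pi _ _ le3) _; rewrite pz3 -pz1; apply: mono_pi.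
exact: leq_trans (ltnW lt_z1) le_p.
Qed.

Definition split_rows h := [set x | nonconst le E x (prev h) h].

(** Let [h] be a break inside one part at the first merging stage. A row nonconstant on it has a red
    entry in the column of that part, which leaves at most [k] parts of rows. Two rows of one part
    differ only in columns of the at most [k] parts that are red for it; each of these is covered by
    two parts of the previous stage, and each of those meets at most two cells, whence [4 * k]. *)
Lemma stage_bounds (t : int) (k n : nat) (M : 'M[entry]_n) (pi : V -> 'I_n) :
  (t <= k%:Z)%R -> sym_twin_ordered t M -> monotone_parts rk pi ->
  red_quotient E M pi -> injective pi -> L != set0 ->
  exists2 h, h \in L & exists n1 (part : V -> 'I_n1),
    [/\ monotone_parts rk part, #|[set part x | x in split_rows h]| <= k
      & forall x y, rk x <= rk y -> part x = part y -> #|touched x y| <= 4 * k].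
Proof.
move=> le_tk STO mono_pi blockM pi_inj L0.
have [|n1 [M1 [pi1 [n2 [pi2 [mono1 mono2 block1 [row1 col1] [[h Lh eh] sep2
  fib]]]]]]] :=
  first_merging_stage STO mono_pi blockM _ L0 (prev := prev).
  move=> h Lh; rewrite (inj_eq pi_inj); apply/eqP => e.
  by have [_ _ _] := L_prevP Lh; rewrite e ltnn.
have nonred x z z' : pi1 z = pi1 z' -> E x z -> ~~ E x z' ->
    M1 (pi1 x) (pi1 z) = red.
  move=> ez Ez nEz; case: (block1 x z) => // e1.
  by case: (block1 x z'); rewrite -ez e1 // => -[e]; rewrite -e Ez in nEz.
exists h => //; exists n1, pi1; split=> //.
  have := le_trans (col1 (pi1 h)) le_tk; rewrite lez_nat; apply: leq_trans.
  apply: subset_leq_card; apply/subsetP => _ /imsetP[x + ->].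
  rewrite !inE => /nonconstP[z [z' [hz hz' Ez nEz]]].
  have part_z w : le (prev h) w && le w h -> pi1 w = pi1 h.
    rewrite !leE => /andP[le1 le2]; apply/eqP.
    by rewrite -val_eqE eqn_leq /= mono1 // -eh mono1.
  by rewrite -(part_z z) // (nonred x z z') // !part_z.
move=> x y le_xy exy; pose R := [set j | M1 (pi1 x) j == red].
pose cells o := [set cellof z | z in [set z | (rk m0 <= rk z) && (pi1 z == o)]].
have sub : touched x y \subset \bigcup_(o in R) cells o.
  apply/subsetP => g /touchedP[z [mz /splitsP[w [w' [hw hw' Ew nEw]]] <-]].
  apply/bigcupP; exists (pi1 z); last by apply: imset_f; rewrite inE mz /=.
  have part_w v : rk x <= rk v <= rk y -> pi1 v = pi1 x.
    case/andP=> le1 le2; apply/eqP.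
    by rewrite -val_eqE eqn_leq /= [X in _ && X]mono1 // exy mono1.
  rewrite inE; case: (block1 w z); rewrite part_w // => e1; first by rewrite e1.
  by case: (block1 w' z); rewrite part_w // e1 // => -[e]; rewrite -e Ew in nEw.
have card_cells o : #|cells o| <= 4.
  have [o1 [o2 Eo]] := fib o.
  pose cells2 o := [set cellof z | z in [set z | (rk m0 <= rk z) && (pi2 z ==
    o)]].
  have sub2 : cells o \subset cells2 o1 :|: cells2 o2.
    apply/subsetP => _ /imsetP[z + ->]; rewrite inE => /andP[mz /eqP /Eo pz].
    by apply/setUP; case: pz => pz; [left|right]; apply: imset_f; rewrite inE
      mz pz /=.
  apply: leq_trans (subset_leq_card sub2) _; apply: leq_trans (leq_card_setU _
    _).1 _.
  by rewrite -[4]/(2 + 2) leq_add // card_cells_part.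
apply: leq_trans (subset_leq_card sub) _.
have := le_trans (row1 (pi1 x)) le_tk; rewrite lez_nat -/R => leR.
apply: leq_trans (_ : \sum_(o in R) 4 <= _); last by rewrite sum_nat_const
  mulnC leq_mul.
elim/big_ind2: _ => [|A a B b leA leB|o _ //]; first by rewrite cards0.
by apply: leq_trans (leq_card_setU _ _).1 _; apply: leq_add.
Qed.

End Cells.

(** * Encoding sets of cells and jumps by vertices *)

Section Encoding.

Variables (V : finType) (E le : rel V) (rk : V -> nat).
Hypotheses (rk_inj : injective rk) (leE : forall x y, le x y = (rk x <= rk y)).
Variables (S : {set V}) (m0 s1 : V).
Hypotheses (Sm0 : m0 \in S) (m0_min : forall s, s \in S -> rk m0 <= rk s).
Hypotheses (Ss1 : s1 \in S) (neq_s1 : s1 != m0).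
Variable L : {set V}.
Hypothesis L_S : L \subset S :\ m0.

Notation prev := (prev rk S m0).
Notation breaks := (breaks E le rk S m0).
Notation heads := (heads m0 L).
Notation cellof := (cellof rk m0 L).
Notation touched := (touched E le rk m0 L).

Variables (mid hi : V -> V).
Hypothesis bounds : forall g, g \in heads ->
  [/\ mid g \in S, hi g \in S, rk g <= rk (mid g), rk g <= rk (hi g)
    & (forall z, rk m0 <= rk z -> incell le (g, hi g) z = (cellof z == g)) /\
      ((hi g = g /\ forall s, s \in S -> rk s <= rk (mid g)) \/
       [/\ hi g \in L, prev (hi g) = mid g & rk g < rk (hi g)])].

Lemma lt_m0_s1 : rk m0 < rk s1.
Proof.
rewrite ltn_neqAle m0_min // andbT.
by apply: contra neq_s1 => /eqP/rk_inj ->.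
Qed.

(** In such a list [Some g] stands for the cell with head [g], and [None] for a jump instruction or
    padding. *)
Definition cells (os : seq (option V)) := [set g | Some g \in os].
Definition ok_cells (os : seq (option V)) := cells os \subset heads.

(** As [m0] precedes [s1], the pair [(s1, m0)] is a jump instruction and names no cell. *)
Definition code (o : option V) : V * V := if o is Some g then (g, hi g) else
  (s1, m0).

Lemma code_le o : (forall g, o = Some g -> g \in heads) ->
  le (code o).1 (code o).2 = (o != None).
Proof.
case: o => [g|_] /=; last by rewrite leE leqNgt lt_m0_s1.
by move=> /(_ g erefl) /bounds [_ _ _ le_g _]; rewrite leE le_g.
Qed.

Lemma incell_code o z : (forall g, o = Some g -> g \in heads) -> rk m0 <= rk z
  ->
  incell le (code o) z = (o == Some (cellof z)).
Proof.
case: o => [g|_ mz] /=.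
  by move=> /(_ g erefl) /bounds [_ _ _ _ [cellE _]] mz; rewrite cellE //
    eq_sym.
rewrite /incell /= !leE mz /=; apply/negP => /andP[_ /eqP e].
by move: neq_s1; rewrite -e eqxx.
Qed.

Lemma ok_some os o g : ok_cells os -> o \in os -> o = Some g -> g \in heads.
Proof. by move=> /subsetP ok oo e; apply: ok; rewrite inE -e. Qed.

Lemma touches_outsideE os u y : ok_cells os ->
  touches_outside E le m0 (map code os) u y = ~~ (touched u y \subset cells os).
Proof.
move=> ok.
have has_cell z : rk m0 <= rk z ->
    has (fun c => incell le c z) (map code os) = (cellof z \in cells os).
  move=> mz; rewrite has_map inE; apply/hasP/idP => [[o oo /=]|Hz].
    by rewrite (incell_code (fun g => ok_some ok oo)) // => /eqP <-.
  exists (Some (cellof z)) => //=.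
  by rewrite (incell_code (fun g => ok_some ok Hz)).
apply/existsP/subsetPn => [[z /and3P[mz nin cr]]|[g /touchedP[z [mz cr <-]]
  nin]].
  rewrite leE in mz; rewrite has_cell // in nin.
  by exists (cellof z) => //; apply/touchedP; exists z.
by exists z; rewrite leE mz has_cell // nin.
Qed.

Lemma touchesE g u y : g \in heads ->
  touches E le m0 (code (Some g)) u y = (g \in touched u y).
Proof.
move=> Hg; have ok g' : Some g = Some g' -> g' \in heads by case=> <-.
apply/existsP/touchedP => [[z /and3P[mz inz cr]]|[z [mz cr e]]]; exists z.
  rewrite leE in mz; split=> //; apply/eqP.
  by move: inz; rewrite incell_code // => /eqP[->].
by rewrite leE mz incell_code // e eqxx.
Qed.

Lemma touches_exactlyE os u y : ok_cells os ->
  touches_exactly E le m0 (map code os) u y = (touched u y == cells os).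
Proof.
move=> ok; rewrite /touches_exactly touches_outsideE // negbK eqEsubset andbC;
  congr (_ && _).
rewrite all_map; apply/allP/subsetP => [H g|H o oo].
  rewrite inE => gg; have := H _ gg; rewrite /= -/(code (Some g)).
  have Hg := ok_some ok gg erefl.
  by rewrite touchesE //; have [_ _ _ le_g _] := bounds Hg; rewrite leE le_g.
case: o oo => [g|] gg /=; last by rewrite leE leqNgt lt_m0_s1.
rewrite -/(code (Some g)) touchesE; last exact: ok_some ok gg erefl.
by rewrite H ?orbT // inE.
Qed.

Lemma jump_candidateE h os c y : ok_cells os ->
  jump_candidate E le m0 (prev h) h (map code os) c y =
  candidate rk (split_rows E le rk S m0 h) touched (cells os) c y.
Proof.
move=> ok; apply/existsP/candidateP => [[u /existsP[w]]|[u [w]]].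
  rewrite touches_outsideE // touches_exactlyE // !leE => /and5P[Du Dw h1 h2
    /and3P[h3 /eqP h4 h5]].
  by exists u, w; rewrite !inE h1 h2.
rewrite !inE => -[Du Dw /andP[h1 h2] h3 [h4 h5]]; exists u; apply/existsP.
by exists w; rewrite touches_outsideE // touches_exactlyE // !leE Du Dw h1 h2
  h3 h4 eqxx -h4 h4.
Qed.

Lemma jumpP h os c y : ok_cells os ->
  reflect (jump_to rk (split_rows E le rk S m0 h) touched (cells os) c y)
    (jump E le m0 (prev h) h (map code os) c y).
Proof.
move=> ok; apply: (iffP and3P).
  rewrite jump_candidateE // => -[Dy hy /forallP my]; split; rewrite ?inE // =>
    y'.
  by rewrite inE => Dy' hy'; have := my y'; rewrite jump_candidateE // Dy' hy'
    leE.
case; rewrite inE => Dy hy my; split; rewrite ?jump_candidateE //.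
by apply/forallP => y'; rewrite jump_candidateE // leE; apply/implyP =>
  /andP[Dy' hy'];
  apply: my; rewrite ?inE.
Qed.

(** The meaning of [reach] on a coded list, with sets of cells in place of pairs of vertices. *)
Fixpoint walk h (os : seq (option V)) c d : Prop :=
  match os with
  | [::] => c = d
  | Some _ :: os' => walk h os' c d
  | None :: os' => exists2 c',
      jump_to rk (split_rows E le rk S m0 h) touched (cells os') c c' & walk h
        os' c' d
  end.

Lemma reachP h os c d : ok_cells os ->
  reflect (walk h os c d) (reach E le m0 (prev h) h (map code os) c d).
Proof.
elim: os c => [|o os IH] c ok; first exact: eqP.
have ok' : ok_cells os.
  apply: subset_trans ok; apply/subsetP => g; rewrite !inE => ->.
  by rewrite orbT.
apply: (iffP idP); rewrite [reach _ _ _ _ _ _ _ _]/=;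
  rewrite (code_le (fun g => ok_some ok (mem_head o os))).
  case: o ok => [g|] ok /=; rewrite ?orbF; first by move/IH; apply.
  by case/existsP=> c' /andP[/jumpP jc /IH r]; exists c'; [apply: jc | apply:
    r].
case: o ok => [g|] ok /= W; rewrite ?orbF; first exact/IH.
case: W => c' jc W; apply/existsP; exists c'; apply/andP; split.
  exact/jumpP.
exact/IH.
Qed.

Lemma cells_cat os1 os2 : cells (os1 ++ os2) = cells os1 :|: cells os2.
Proof. by apply/setP => g; rewrite !inE mem_cat. Qed.

Lemma cells_enum (F : {set V}) : cells (map Some (enum F)) = F.
Proof.
apply/setP => g; rewrite inE mem_map ?mem_enum //.
by move=> a b [].
Qed.

Lemma walk_somes h (s : seq V) os c d : walk h (map Some s ++ os) c d = walk h
  os c d.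
Proof. by elim: s. Qed.

(* Since the sets decrease, each of their elements need only be listed once,
   after the last jump that uses it. *)
Lemma walk_of_jumps h (Fs : seq {set V}) :
  sorted (fun A B : {set V} => B \subset A) Fs ->
  exists os, [/\ cells os = head set0 Fs, size os = size Fs + #|head set0 Fs|
    & forall c d, walk h os c d <->
        jumps_to rk (split_rows E le rk S m0 h) touched Fs c d].
Proof using Type.
elim: Fs => [_|F Fs IH /= path_Fs].
  by exists [::]; split; [apply/setP => g; rewrite !inE | rewrite cards0 |].
have [os [cells_os size_os W]] := IH (path_sorted path_Fs).
have sub : cells os \subset F.
  rewrite cells_os; case: (Fs) path_Fs => [|F' Fs'] /=; first by rewrite
    sub0set.
  by case/andP.
have cellsF : cells (map Some (enum (F :\: cells os)) ++ os) = F.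
  rewrite cells_cat cells_enum; apply/setP => g.
  rewrite in_setU in_setD; case: (boolP (g \in cells os)) => [/(subsetP sub)
    ->|] //=.
  by rewrite orbF.
exists (None :: map Some (enum (F :\: cells os)) ++ os); split.
- by rewrite -[RHS]cellsF; apply/setP => g; rewrite !inE.
- rewrite /= size_cat size_map -cardE size_os -cells_os cardsDS //.
  by rewrite addnCA subnK ?subset_leq_card // addSn.
move=> c d /=; rewrite cellsF.
by split=> -[c' jc r]; exists c' => //; move: r; rewrite walk_somes => /W.
Qed.

End Encoding.

(** * Classes of rows *)

Section Rows.

Variables (V : finType) (E le : rel V) (rk : V -> nat).
Hypotheses (rk_inj : injective rk) (leE : forall x y, le x y = (rk x <= rk y)).
Variables (S : {set V}) (m0 s1 : V).
Hypotheses (Sm0 : m0 \in S) (m0_min : forall s, s \in S -> rk m0 <= rk s).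
Hypotheses (Ss1 : s1 \in S) (neq_s1 : s1 != m0).
Variable L : {set V}.
Hypothesis L_S : L \subset S :\ m0.

Notation prev := (prev rk S m0).
Notation breaks := (breaks E le rk S m0).
Notation heads := (heads m0 L).
Notation cellof := (cellof rk m0 L).
Notation touched := (touched E le rk m0 L).

Variables (mid hi : V -> V).
Hypothesis bounds : forall g, g \in heads ->
  [/\ mid g \in S, hi g \in S, rk g <= rk (mid g), rk g <= rk (hi g)
    & (forall z, rk m0 <= rk z -> incell le (g, hi g) z = (cellof z == g)) /\
      ((hi g = g /\ forall s, s \in S -> rk s <= rk (mid g)) \/
       [/\ hi g \in L, prev (hi g) = mid g & rk g < rk (hi g)])].

Let headsS g : g \in heads -> g \in S.
Proof. exact: (heads_S rk_inj Sm0 m0_min L_S). Qed.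

Lemma cellof_hull g w : g \in heads -> rk g <= rk w <= rk (mid g) -> cellof w =
  g.
Proof.
move=> Hg /andP[le_gw le_wm]; have [Smid Shi le_gm le_gh [cellE H]] := bounds
  Hg.
have mw : rk m0 <= rk w by apply: leq_trans le_gw; apply/m0_min/(headsS Hg).
apply/eqP; rewrite -cellE // /incell /= !leE le_gw /=.
case: H => [[-> _]|[Lhi prhi _]]; first by rewrite eqxx orbT.
have [_ _ _] := L_prevP rk_inj Sm0 m0_min L_S Lhi.
by rewrite prhi -ltnNge => lt_mh _; rewrite (leq_ltn_trans le_wm).
Qed.

Lemma cellof_head g : g \in heads -> cellof g = g.
Proof.
by move=> Hg; apply: cellof_hull; rewrite // leqnn; case: (bounds Hg).
Qed.

(** Beyond [mid g] a cell contains no element of [S]; the next one, if any, is [hi g], which begins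
    another cell. *)
Lemma gap_next g z s : g \in heads -> rk m0 <= rk z -> cellof z = g ->
  rk (mid g) < rk z -> s \in S -> rk (mid g) < rk s ->
  [/\ hi g \in L, prev (hi g) = mid g, rk z < rk (hi g) & rk (hi g) <= rk s].
Proof.
move=> Hg mz cz lt_mz Ss lt_ms; have [Smid Shi le_gm le_gh [cellE H]] := bounds
  Hg.
case: H => [[_ maxm]|[Lhi prhi lt_gh]].
  by move: lt_ms; rewrite ltnNge maxm.
have [_ _ _ _ max_p] := L_prevP rk_inj Sm0 m0_min L_S Lhi.
split=> //; last first.
  by rewrite leqNgt; apply: contraTN lt_ms => /(max_p _ Ss); rewrite prhi
    -leqNgt.
have := cellE _ mz; rewrite cz eqxx /incell /= !leE -ltnNge.
case/andP=> _ /orP[//|/eqP e].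
by move: lt_gh; rewrite e ltnn.
Qed.

Lemma breaksN v h : h \in S -> h != m0 -> h \notin breaks v ->
  ~~ nonconst le E v (prev h) h.
Proof. by move=> Sh neq_h; rewrite inE Sh neq_h. Qed.

(** The gap of [S] around [z] is not a break, since its right end would begin another cell. So the
    row has the same value at [z] as at the left end of that gap, which is not before [g], and
    induction applies. *)
Lemma hull_const v g z : breaks v = L -> g \in heads ->
  rk g <= rk z <= rk (mid g) -> E v z = E v g.
Proof.
move=> bv Hg; have [s] := ubnP (rk z); elim: s z => // s IH z le_s /andP[le_gz
  le_zm].
have [/rk_inj -> //|neq_gz] := eqVneq (rk g) (rk z).
have lt_gz : rk g < rk z by rewrite ltn_neqAle neq_gz.
have [Smid _ _ _ _] := bounds Hg.
case: (@arg_minnP _ (mid g) (fun s => (s \in S) && (rk z <= rk s)) rk) => [|h].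
  by rewrite Smid.
move=> /andP[Sh le_zh] min_h.
have le_hm : rk h <= rk (mid g) by apply: min_h; rewrite Smid.
have lt_gh : rk g < rk h by apply: leq_trans le_zh.
have neq_h : h != m0.
  by apply: contraTneq lt_gh => ->; rewrite -leqNgt m0_min // (headsS Hg).
have [Sp lt_p max_p] := prevP rk_inj Sm0 m0_min Sh neq_h.
have lt_pz : rk (prev h) < rk z.
  by rewrite ltnNge; apply: contraTN lt_p => le_zp; rewrite -leqNgt min_h // Sp.
have nLh : h \notin breaks v.
  rewrite bv; apply/negP => Lh.
  have Hh : h \in heads by rewrite inE Lh orbT.
  have e : g = h by rewrite -(cellof_head Hh) (cellof_hull Hg) // (ltnW lt_gh).
  by move: lt_gh; rewrite e ltnn.
have le_gp := max_p _ (headsS Hg) lt_gh.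
rewrite (nonconstPn (breaksN Sh neq_h nLh) (z' := prev h)) ?leE ?leqnn ?le_zh
  ?(ltnW lt_pz) ?(ltnW lt_p) //.
apply: IH; first exact: leq_trans lt_pz le_s.
by rewrite le_gp (leq_trans (ltnW lt_pz)).
Qed.

(** A zero bit needs an element of [S] other than [g]: [s1] if [g = m0], and [m0] otherwise. The
    entry for [None] is satisfied by every row, as the interval from [s1] to [m0] is empty. *)
Definition row_entry v (o : option V) : V * V * V * V :=
  if o is Some g then
    (g, mid g, hi g, if E v g then g else if g == m0 then s1 else m0)
  else (s1, m0, m0, m0).

Lemma row_entryP v x g : g \in heads ->
  reflect ((forall z, rk g <= rk z <= rk (mid g) -> E x z = E v g) /\
           (rk g < rk (hi g) -> nonconst le E x (mid g) (hi g)))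
    (row_ok E le x (row_entry v (Some g))).
Proof.
move=> Hg; have sgE : ((if E v g then g else if g == m0 then s1 else m0) == g)
  = E v g.
  case: (E v g); first exact: eqxx.
  have [->|neq] := eqVneq g m0; first exact/negbTE.
  by rewrite eq_sym; apply/negbTE.
rewrite /row_ok /= sgE leE [rk (hi g) <= _]leqNgt; apply: (iffP andP) => -[H1
  H2]; split.
- by move=> z hz; have := forallP H1 z; rewrite !leE hz => /eqP.
- by move=> lt; move: H2; rewrite lt.
- by apply/forallP => z; rewrite !leE; apply/implyP => hz; rewrite H1.
- by case: (boolP (_ < _)) => //= /H2.
Qed.

Lemma row_entry_self v g : breaks v = L -> g \in heads ->
  row_ok E le v (row_entry v (Some g)).
Proof.
move=> bv Hg; apply/row_entryP => //; split=> [z|lt]; first exact: hull_const.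
have [_ _ _ _ [_ [[e _]|[Lh <- _]]]] := bounds Hg.
  by move: lt; rewrite e ltnn.
by move: Lh; rewrite -bv inE => /and3P[].
Qed.

(* The columns on which two rows of the same class may differ. *)
Definition gap_column (R : {set V}) z :=
  (cellof z \in R) && (rk (mid (cellof z)) < rk z).

Section Agreement.

Variables (v x : V) (R : {set V}).
Hypotheses (bv : breaks v = L) (R_heads : R \subset heads).
Hypothesis rows_x : forall g, g \in R -> row_ok E le x (row_entry v (Some g)).
Hypothesis off_R : forall z, rk m0 <= rk z -> cellof z \notin R -> E x z = E v
  z.

Lemma agree z : rk m0 <= rk z -> ~~ gap_column R z -> E x z = E v z.
Proof.
rewrite negb_and => mz; have [Rz /=|nRz _] := boolP (cellof z \in R); last
  exact: off_R.
rewrite -leqNgt => le_zm; have Hg := subsetP R_heads _ Rz.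
have [_ le_cz _] := cellofP L mz.
have [cx _] := row_entryP v x Hg (rows_x Rz).
by rewrite cx ?le_cz // (hull_const bv Hg) ?le_cz.
Qed.

Lemma gap_column_S s : s \in S -> ~~ gap_column R s.
Proof.
move=> Ss; apply/negP => /andP[Rs lt_s]; have Hg := subsetP R_heads _ Rs.
have [_ _] := gap_next Hg (m0_min Ss) erefl lt_s Ss lt_s.
by rewrite ltnNge => /negP.
Qed.

(** A gap of [S] that contains a column where the rows may differ is the final gap of a cell in [R],
    and there [row_ok] forces both rows to be nonconstant. On any other gap the two rows are
    equal. *)
Lemma agree_breaks : breaks x = L.
Proof.
rewrite -bv; apply/setP => h; rewrite !inE; have [Sh|//] := boolP (h \in S).
have [//|neq_h] := eqVneq h m0; rewrite /=.
have [Sp lt_p max_p] := prevP rk_inj Sm0 m0_min Sh neq_h.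
have mp := m0_min Sp.
have [/existsP[z /and3P[le_pz le_zh gz]]|nogap] :=
    boolP [exists z, [&& rk (prev h) <= rk z, rk z <= rk h & gap_column R z]].
  have mz := leq_trans mp le_pz.
  have /andP[Rz lt_mz] := gz; have Hg := subsetP R_heads _ Rz.
  have [Lhi prhi lt_zhi le_hi] :=
    gap_next Hg mz erefl lt_mz Sh (leq_trans lt_mz le_zh).
  have eh : hi (cellof z) = h.
    apply: rk_inj; apply/eqP; rewrite eqn_leq le_hi leqNgt.
    have [Shi _ _ _ _] := L_prevP rk_inj Sm0 m0_min L_S Lhi.
    apply: contraTN lt_zhi => /(max_p _ Shi) le_hip.
    by rewrite -leqNgt (leq_trans le_hip).
  have [_ _ _ le_gh [_ _]] := bounds Hg.
  have [_ le_cz _] := cellofP L mz.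
  have := row_entry_self bv Hg => /(row_entryP v v Hg)[_ nv].
  have [_ nx] := row_entryP v x Hg (rows_x Rz).
  have lt : rk (cellof z) < rk (hi (cellof z)) by apply: leq_ltn_trans lt_zhi.
  by rewrite -eh prhi nv // nx.
have eqxv z : le (prev h) z && le z h -> E x z = E v z.
  rewrite !leE => /andP[le_pz le_zh]; apply: agree; first exact: leq_trans
    le_pz.
  by apply: contra nogap => gz; apply/existsP; exists z; rewrite le_pz le_zh.
by apply/nonconstP/nonconstP => -[z [z' [hz hz' Ez nEz]]]; exists z, z';
  split=> //;
  rewrite ?eqxv // -?eqxv.
Qed.

End Agreement.
End Rows.

(** * Definability and crossings of a class *)

Section Classes.

Variables (V : finType) (E le : rel V) (rk : V -> nat).
Hypotheses (rk_inj : injective rk) (leE : forall x y, le x y = (rk x <= rk y)).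
Variables (S : {set V}) (m0 s1 : V).
Hypotheses (Sm0 : m0 \in S) (m0_min : forall s, s \in S -> rk m0 <= rk s).
Hypotheses (Ss1 : s1 \in S) (neq_s1 : s1 != m0).

Notation prev := (prev rk S m0).
Notation breaks := (breaks E le rk S m0).
Notation heads := (heads m0).
Notation cellof := (cellof rk m0).
Notation touched := (touched E le rk m0).
Notation split_rows := (split_rows E le rk S m0).

(** A value [(h, c, ds)] of [runs_of] consists of a break, the first row nonconstant on it and the
    starts of the later runs. It depends only on [L], so all vertices with the same breaks share
    it. *)
Variables (k K : nat) (runs_of : {set V} -> V * V * seq V).
Hypotheses (K_gt0 : 0 < K).

Hypothesis runs_ofP : forall L h c ds, runs_of L = (h, c, ds) ->
  L \subset S :\ m0 -> L != set0 ->
  (forall h', h' \in L -> split_rows h' != set0) ->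
  [/\ h \in L, c \in split_rows h, forall x, x \in split_rows h -> rk c <= rk x,
      runs rk (split_rows h) (touched L) K c ds & size ds < k].

(** The run of [v] is recorded by the set of starts not after [v]; without breaks there are no runs
    to record. *)
Definition starts v : {set V} :=
  if breaks v == set0 then set0 else
  let: (h, c, ds) := runs_of (breaks v) in [set s in c :: ds | rk s <= rk v].

Definition key v := ([set s in S | E v s], breaks v, starts v).

Lemma breaks_sub v : breaks v \subset S :\ m0.
Proof. by apply/subsetP => h; rewrite !inE => /and3P[-> -> _]. Qed.

Lemma breaks_split v h : h \in breaks v -> v \in split_rows h.
Proof. by rewrite !inE => /and3P[]. Qed.

(** The starts not after a vertex form an initial segment of the list, which ends at the start of
    the run of that vertex. *)
Lemma starts_inrun (D : {set V}) (L : {set V}) c ds i v x :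
  c \in D -> runs rk D (touched L) K c ds -> i <= size ds -> x \in D ->
  inrun rk D c ds i v ->
  ([set s in c :: ds | rk s <= rk x] == [set s in c :: ds | rk s <= rk v]) =
  inrun rk D c ds i x.
Proof.
move=> Dc runs_ds lei Dx /and3P[Dv le_iv /implyP lt_v].
have leS a b : a <= b -> b <= size ds -> rk (start c ds a) <= rk (start c ds b).
  exact: (start_le Dc runs_ds).
have st_mem j : j <= size ds -> start c ds j \in c :: ds.
  by move=> lej; apply: mem_nth.
apply/eqP/and3P => [/setP es|[_ le_ix /implyP lt_x]].
  split=> //; first by have := es (start c ds i); rewrite !in_set st_mem //
    le_iv /= => ->.
  apply/implyP => lti; have := es (start c ds i.+1).
  by rewrite !in_set st_mem //= [rk _ <= rk v]leqNgt lt_v // ltnNge => ->.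
apply/setP => s; rewrite !in_set; case: (boolP (s \in c :: ds)) => //= sin.
have lej : index s (c :: ds) <= size ds by rewrite -ltnS -[(size ds).+1]/(size
  (c :: ds)) index_mem.
have <- : start c ds (index s (c :: ds)) = s by apply: nth_index.
have [le_ji|lt_ij] := leqP (index s (c :: ds)) i.
  by rewrite !(leq_trans (leS _ _ le_ji lei)).
have lti : i < size ds by apply: leq_trans lt_ij lej.
have lo := leS _ _ lt_ij lej.
by rewrite [LHS]leqNgt [RHS]leqNgt (leq_trans (lt_x lti)) // (leq_trans (lt_v
  lti)).
Qed.

Section OneClass.

Variables (v : V) (mid hi : V -> V).
Let L := breaks v.
Hypothesis bounds : forall g, g \in heads L ->
  [/\ mid g \in S, hi g \in S, rk g <= rk (mid g), rk g <= rk (hi g)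
    & (forall z, rk m0 <= rk z -> incell le (g, hi g) z = (cellof L z == g)) /\
      ((hi g = g /\ forall s, s \in S -> rk s <= rk (mid g)) \/
       [/\ hi g \in L, prev (hi g) = mid g & rk g < rk (hi g)])].

Let entry := row_entry E m0 s1 mid hi v.

Lemma rows_okP ros x : reflect (forall g, g \in cells ros -> row_ok E le x
  (entry (Some g)))
  (all (row_ok E le x) (map entry ros)).
Proof.
rewrite all_map; apply: (iffP allP) => [H g|H [g|] og]; first by rewrite inE =>
  /H.
  by apply: H; rewrite inE.
have lt := lt_m0_s1 rk_inj m0_min Ss1 neq_s1.
rewrite /= /row_ok leE (ltnW lt) andbT; apply/forallP => z; rewrite !leE.
by apply/implyP => /andP[h1 h2]; move: lt; rewrite ltnNge (leq_trans h1).
Qed.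

Lemma key_rows x g : key x = key v -> g \in heads L -> row_ok E le x (entry
  (Some g)).
Proof.
case=> eS eb _ Hg; have Sg := heads_S rk_inj Sm0 m0_min (breaks_sub v) Hg.
have eE : E x g = E v g by move/setP: eS => /(_ g); rewrite !inE Sg.
have -> : entry (Some g) = row_entry E m0 s1 mid hi x (Some g).
  by rewrite /entry /row_entry eE.
exact: (row_entry_self rk_inj leE Sm0 m0_min neq_s1 (breaks_sub v) bounds).
Qed.

Lemma rows_key (R : {set V}) x : R \subset heads L ->
  (forall g, g \in R -> row_ok E le x (entry (Some g))) ->
  (forall z, rk m0 <= rk z -> cellof L z \notin R -> E x z = E v z) ->
  [set s in S | E x s] = [set s in S | E v s] /\ breaks x = breaks v.
Proof.
move=> R_h rows off; have sub := breaks_sub v; split; last first.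
  exact: (agree_breaks rk_inj leE Sm0 m0_min neq_s1 sub bounds erefl R_h rows
    off).
apply/setP => s; rewrite !inE; case: (boolP (s \in S)) => //= Ss.
apply: (agree rk_inj leE Sm0 m0_min neq_s1 sub bounds erefl R_h rows off).
  exact: m0_min.
exact: (gap_column_S rk_inj leE Sm0 m0_min sub bounds R_h).
Qed.

Variables (A : {set V}) (q : nat).
Hypothesis A_m0 : forall a, a \in A -> rk m0 <= rk a.
Hypothesis gaps : forall s, s \in S ->
  #|[set a in A | (rk s < rk a) &&
       [forall s' in S, (rk s' <= rk s) || (rk a < rk s')]]| <= q.

(** A vertex of [A] that crosses the class lies in the final gap of a cell of [R], and each such gap
    holds at most [q] elements of [A]. *)
Lemma class_crossings (R : {set V}) : R \subset heads L -> #|R| <= K ->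
  (forall x, key x = key v ->
     forall z, rk m0 <= rk z -> cellof L z \notin R -> E x z = E v z) ->
  #|[set a in A | crosses E a [set x | key x == key v]]| <= K * q.
Proof.
move=> R_h cardR off; have sub := breaks_sub v.
pose gapset g := [set a in A | (rk (mid g) < rk a) &&
       [forall s' in S, (rk s' <= rk (mid g)) || (rk a < rk s')]].
have agr x z : key x = key v -> rk m0 <= rk z -> ~~ gap_column rk m0 L mid R z
  ->
    E x z = E v z.
  move=> ex mz; apply: (agree rk_inj leE Sm0 m0_min neq_s1 sub bounds erefl
    R_h) => //.
    by move=> g /(subsetP R_h); apply: key_rows.
  exact: off.
have sub_gap : [set a in A | crosses E a [set x | key x == key v]] \subset
    \bigcup_(g in R) gapset g.
  apply/subsetP => a; rewrite inE => /andP[Aa /exists_inP[x]].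
  rewrite inE => /eqP kx /exists_inP[x']; rewrite inE => /eqP kx' /andP[Ea nEa].
  have ma := A_m0 Aa.
  have /andP[Ra lt_a] : gap_column rk m0 L mid R a.
    apply: contraNT nEa => ngap.
    by rewrite (agr x') // -(agr x).
  apply/bigcupP; exists (cellof L a) => //; rewrite inE Aa lt_a /=.
  apply/forall_inP => s Ss; rewrite leqNgt; have [lt_s|//] := boolP (_ < rk s).
  have Hg := subsetP R_h _ Ra.
  have [_ _ lt_ah le_hs] :=
    gap_next rk_inj leE Sm0 m0_min sub bounds Hg ma erefl lt_a Ss lt_s.
  exact: leq_trans lt_ah le_hs.
apply: leq_trans (subset_leq_card sub_gap) _.
apply: leq_trans (_ : \sum_(g in R) q <= _); last by rewrite sum_nat_const
  leq_mul2r cardR orbT.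
elim/big_rec2: _ => [|g n B Rg IH]; first by rewrite cards0.
apply: leq_trans (leq_card_setU _ _).1 _; apply: leq_add => //.
apply: gaps; have Hg := subsetP R_h _ Rg; by case: (bounds Hg).
Qed.

Let cd := code m0 s1 hi.

Lemma ends_entry ros : map (@ends V) (map entry ros) = map cd ros.
Proof. by rewrite -map_comp; apply: eq_map => -[g|]. Qed.

(** The class is described by its break, a walk to the start of its run and the row entries for the
    cells of that run. The walk takes fewer than [k] jumps and at most [K] cells; both lists are
    padded to lengths that do not depend on the class. *)
Lemma class_definable M : k + K <= M -> exists p h (os ros : seq (option V)),
  [/\ size os = M, size ros = K, p \in S /\ h \in S,
      cells os \subset heads L /\ cells ros \subset heads L
    & (forall x, cell_pred E le m0 s1 p h (map cd os) (map entry ros) x =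
         (key x == key v)) /\
      #|[set a in A | crosses E a [set x | key x == key v]]| <= K * q].
Proof.
move=> leM; have sub := breaks_sub v.
have Hm0 : m0 \in heads L by apply: setU11.
have cells_pad (s : seq (option V)) n : cells (s ++ nseq n None) = cells s.
  by apply/setP => g; rewrite !inE mem_cat mem_nseq andbF orbF.
have m0s1 : (m0 == s1) = false by rewrite eq_sym; apply/negbTE.
(* Without breaks there is a single cell, with head [m0], and its entry alone describes the
   class. *)
have [L0|L0] := eqVneq L set0.
  have cell1 : cells [:: Some m0] = [set m0].
    by apply/setP => g; rewrite !inE; apply/eqP/eqP => [[]|->].
  have cellT z : rk m0 <= rk z -> cellof L z \in [set m0].
    by case/(cellofP L) => + _ _; rewrite /heads L0 setU0.
  have R_h : [set m0] \subset heads L by rewrite sub1set.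
  pose ros := [:: Some m0] ++ nseq K.-1 None.
  have cells_ros : cells ros = [set m0] by rewrite cells_pad.
  exists m0, m0, (nseq M (Some m0)), ros; split=> //.
  - by rewrite size_nseq.
  - by rewrite size_cat size_nseq /=; lia.
  - rewrite cells_ros; split=> //.
    by apply/subsetP => g; rewrite inE mem_nseq => /andP[_ /eqP[->]].
  split; last first.
    apply: (class_crossings R_h); first by rewrite cards1.
    by move=> x _ z mz; rewrite cellT.
  move=> x; rewrite /cell_pred m0s1 eqxx orFb orTb andbT; apply/rows_okP/eqP.
    rewrite cells_ros => rows.
    have [|eS eb] := rows_key R_h rows; first by move=> z mz; rewrite cellT.
    by rewrite /key /starts eS eb -/L L0 eqxx.
  by rewrite cells_ros => kx g /set1P ->; apply: key_rows.
case ed: (runs_of L) => [[h c] ds].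
have [h' Lh'|Lh Dc c_min runs_ds size_ds] := runs_ofP ed sub L0.
  by apply/set0Pn; exists v; apply: breaks_split.
have [Sh neq_h Sp lt_p _] := L_prevP rk_inj Sm0 m0_min sub Lh.
have Dv : v \in split_rows h by apply: breaks_split.
have mono := @touched_mono V E le rk leE m0 L.
have cat := @touched_cat V E le rk leE m0 L.
have refl := @touched_refl V E le rk rk_inj leE m0 L.
have [i lei rv] := inrun_ex ds c_min Dv.
pose R := run_cells rk (split_rows h) (touched L) c ds i.
have R_h : R \subset heads L by apply: touched_heads.
have cardR : #|R| <= K by apply: (card_run_cells rk_inj Dc runs_ds refl).
have [Fs [sorted_Fs size_Fs Fs_ok jFs]] :=
  start_reachable rk_inj mono cat Dc c_min runs_ds refl lei.
have [os0 [cells0 size0 walk0]] := walk_of_jumps E le rk S m0 L h sorted_Fs.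
have [h0 h0K] : head set0 Fs \subset heads L /\ #|head set0 Fs| <= K.
  case: (Fs) Fs_ok => [_|F Fs' /(_ F (mem_head _ _)) [[i' lei' ->] _]] /=.
    by rewrite sub0set cards0.
  by split; [apply: touched_heads | apply: card_run_cells].
(* The walk is padded in front with a cell, since [None] would be a jump and a jump reads only the
   cells after it. The row entries can be padded with [None]. *)
pose os := nseq (M - size os0) (Some m0) ++ os0.
pose ros := map Some (enum R) ++ nseq (K - #|R|) None.
have cells_ros : cells ros = R by rewrite cells_pad cells_enum.
have ok_ros : cells ros \subset heads L by rewrite cells_ros.
have ok_os : cells os \subset heads L.
  rewrite cells_cat subUset cells0 h0 andbT; apply/subsetP => g.
  by rewrite inE mem_nseq => /andP[_ /eqP[->]].
have walk_os a b : walk E le rk S m0 L h os a b <->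
    jumps_to rk (split_rows h) (touched L) Fs a b.
  by rewrite -walk0 /os; elim: (M - size os0).
have size_os0 : size os0 <= M.
  rewrite size0; apply: leq_trans leM; apply: leq_add => //.
  by apply: leq_trans size_Fs _; apply: leq_trans lei (ltnW size_ds).
exists (prev h), h, os, ros; split=> //.
- by rewrite size_cat size_nseq subnK.
- by rewrite size_cat size_map -cardE size_nseq subnKC.
(* Outside the cells of the run all its rows agree with its first row, in particular with each
   other. *)
have off x : inrun rk (split_rows h) c ds i x ->
    forall z, rk m0 <= rk z -> cellof L z \notin R -> E x z = E v z.
  move=> rx z mz nR.
  have same w : inrun rk (split_rows h) c ds i w -> E w z = E (start c ds i) z.
    rewrite (inrunE rk_inj mono Dc runs_ds refl _ lei) => /and3P[_ le_w sub_w].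
    apply: (touched_const leE le_w mz); apply: contra nR; exact: (subsetP
      sub_w).
  by rewrite (same x) ?(same v).
have key_run x : key x = key v -> inrun rk (split_rows h) c ds i x.
  case=> _ eb; rewrite /starts eb -/L (negbTE L0) ed => es.
  have Dx : x \in split_rows h by apply: breaks_split; rewrite eb.
  by rewrite -(starts_inrun Dc runs_ds lei Dx rv); apply/eqP.
split; last first.
  apply: (class_crossings R_h cardR) => x kx; exact/off/key_run.
have p_h : (prev h == h) = false by apply: contraTF lt_p => /eqP ->; rewrite
  ltnn.
move=> x; rewrite /cell_pred m0s1 p_h !orFb ends_entry; apply/andP/eqP.
  case=> /rows_okP; rewrite cells_ros => rows /andP[Dx /existsP[d0
    /existsP[d]]].
  case/and4P=> /andP[Dd0 /forallP min_d0].
  have -> : d0 = c.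
    apply: rk_inj; apply/eqP; rewrite eqn_leq c_min ?inE // andbT -leE.
    by have := min_d0 c; rewrite inE in Dc; rewrite Dc.
  move/(reachP E rk_inj leE m0_min Ss1 neq_s1 bounds _ _ _ ok_os)/walk_os => W.
  rewrite (jumps_to_fun rk_inj W jFs) leE (touches_outsideE E leE neq_s1 bounds
    _ _ ok_ros).
  rewrite negbK cells_ros => le_x sub_x.
  have rx : inrun rk (split_rows h) c ds i x.
    by rewrite (inrunE rk_inj mono Dc runs_ds refl _ lei) inE Dx le_x.
  have [eS eb] := rows_key R_h rows (off x rx).
  rewrite /key eS eb /starts eb -/L (negbTE L0) ed; congr (_, _).
  apply/eqP; rewrite (starts_inrun Dc runs_ds lei _ rv) // inE; exact: Dx.
move=> kx; split; first by apply/rows_okP => g; rewrite cells_ros => /(subsetP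
  R_h); apply: key_rows.
have := key_run x kx; rewrite (inrunE rk_inj mono Dc runs_ds refl _ lei) =>
  /and3P[Dx le_x sub_x].
rewrite inE in Dx; rewrite Dx; apply/existsP; exists c; apply/existsP; exists
  (start c ds i).
apply/and4P; split.
- apply/andP; split; first by rewrite inE in Dc.
  by apply/forallP => y; apply/implyP => Dy; rewrite leE c_min // inE.
- by apply/(reachP E rk_inj leE m0_min Ss1 neq_s1 bounds _ _ _ ok_os)/walk_os.
- by rewrite leE.
by rewrite (touches_outsideE E leE neq_s1 bounds _ _ ok_ros) negbK cells_ros.
Qed.
End OneClass.
End Classes.

(** * Evenly spaced subsets *)

Section Ranks.

Variables (V : finType) (le : rel V).
Hypothesis le_total : total_order le.

Lemma sorted_index_le (s : seq V) : sorted le s -> uniq s ->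
  {in s &, forall x y, le x y = (index x s <= index y s)}.
Proof.
have [refl anti tr tot] := le_total => sorted_s uniq_s x y xs ys.
apply/idP/idP; last exact: (sorted_leq_index tr refl sorted_s).
move=> le_xy; rewrite leqNgt; apply/negP => lt_yx.
have le_yx := sorted_leq_index tr refl sorted_s _ _ ys xs (ltnW lt_yx).
by move: lt_yx; rewrite (anti x y) ?ltnn // le_xy.
Qed.

Definition order_seq (A : {pred V}) := [seq x <- sort le (enum V) | x \in A].

Lemma order_seq_uniq A : uniq (order_seq A).
Proof. by rewrite filter_uniq // sort_uniq enum_uniq. Qed.

Lemma order_seq_sorted A : sorted le (order_seq A).
Proof.
have [_ _ tr tot] := le_total.
by rewrite sorted_filter // sort_sorted.
Qed.

Lemma mem_order_seq A x : (x \in order_seq A) = (x \in A).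
Proof. by rewrite mem_filter mem_sort mem_enum andbT. Qed.

Lemma size_order_seq (A : {set V}) : size (order_seq A) = #|A|.
Proof.
rewrite cardE; apply: perm_size; apply: uniq_perm; rewrite ?order_seq_uniq
  ?enum_uniq //.
by move=> x; rewrite mem_order_seq mem_enum.
Qed.

Definition rank x := index x (sort le (enum V)).

Lemma rankE x y : le x y = (rank x <= rank y).
Proof.
have [_ _ _ tot] := le_total.
by apply: sorted_index_le; rewrite ?sort_sorted ?sort_uniq ?enum_uniq ?mem_sort
  ?mem_enum.
Qed.

Lemma rank_inj : injective rank.
Proof.
have [refl anti _ _] := le_total => x y e; apply: anti.
by rewrite !rankE e leqnn.
Qed.

Lemma adj_quotient (E : rel V) : exists pi : V -> 'I_(size (sort le (enum V))),
  [/\ monotone_parts rank pi, red_quotient E (adj_mx E (sort le (enum V))) pi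
    & injective pi].
Proof.
have lt x : index x (sort le (enum V)) < size (sort le (enum V)).
  by rewrite index_mem mem_sort mem_enum.
exists (fun x => Ordinal (lt x)); split=> [x y //|x y|x y [e]]; last exact:
  rank_inj.
right; rewrite mxE !(tnth_nth x) /= !nth_index //.
  by rewrite mem_sort mem_enum.
by rewrite mem_sort mem_enum.
Qed.

Variables (A : {set V}) (q : nat).

Let sA := order_seq A.

Definition spaced := [set x in A | q.+1 %| index x sA].

Lemma mem_nth_spaced x0 i : i * q.+1 < #|A| -> nth x0 sA (i * q.+1) \in spaced.
Proof.
move=> lti; have lts : i * q.+1 < size sA by rewrite size_order_seq.
rewrite inE -mem_order_seq mem_nth //=.
by rewrite index_uniq ?order_seq_uniq // dvdn_mull.
Qed.

Lemma index_sA x0 i : i < #|A| -> index (nth x0 sA i) sA = i.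
Proof. by move=> lti; rewrite index_uniq ?order_seq_uniq ?size_order_seq. Qed.

Lemma rank_sA x y : x \in A -> y \in A -> (rank x <= rank y) = (index x sA <=
  index y sA).
Proof.
move=> Ax Ay; rewrite -rankE.
by apply: sorted_index_le; rewrite ?order_seq_sorted ?order_seq_uniq
  ?mem_order_seq.
Qed.

Lemma spaced_gaps s : s \in spaced ->
  #|[set a in A | (rank s < rank a) &&
       [forall s' in spaced, (rank s' <= rank s) || (rank a < rank s')]]| <= q.
Proof.
rewrite inE => /andP[As /dvdnP[i Ei]].
pose f (j : 'I_q) := nth s sA (index s sA + j.+1).
apply: leq_trans (_ : #|[set f j | j : 'I_q]| <= q); last first.
  by apply: leq_trans (leq_imset_card _ _) _; rewrite card_ord.
apply: subset_leq_card; apply/subsetP => a; rewrite inE => /and3P[Aa].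
rewrite ltnNge rank_sA // -ltnNge => lt_sa /forall_inP gap.
have lta : index a sA < #|A| by rewrite -size_order_seq index_mem mem_order_seq.
(* Otherwise the next multiple of [q.+1] would be the index of an element of [spaced] after [s] and
   not after [a]. *)
have lt_q : index a sA < index s sA + q.+1.
  rewrite ltnNge; apply/negP; rewrite Ei -mulSnr => le_a.
  have lt_i : i.+1 * q.+1 < #|A| by apply: leq_ltn_trans lta.
  have := gap _ (mem_nth_spaced s lt_i).
  have Ans : nth s sA (i.+1 * q.+1) \in A by have := mem_nth_spaced s lt_i;
    rewrite inE => /andP[].
  by rewrite ltnNge !rank_sA // index_sA // Ei leq_mul2r ltnn orbF le_a.
have ltj : (index a sA - index s sA).-1 < q by lia.
apply/imsetP; exists (Ordinal ltj) => //; rewrite /f /=.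
have -> : index s sA + (index a sA - index s sA).-1.+1 = index a sA by lia.
by rewrite nth_index // mem_order_seq.
Qed.

Lemma card_spaced : #|spaced| <= (#|A| %/ q.+1).+1.
Proof.
have [->|/set0Pn[x0 Ax0]] := eqVneq spaced set0; first by rewrite cards0.
pose f (j : 'I_(#|A| %/ q.+1).+1) := nth x0 sA (j * q.+1).
apply: leq_trans (_ : #|[set f j | j : 'I_(#|A| %/ q.+1).+1]| <= _); last first.
  by apply: leq_trans (leq_imset_card _ _) _; rewrite card_ord.
apply: subset_leq_card; apply/subsetP => a; rewrite inE => /andP[Aa /dvdnP[i
  Ei]].
have lta : index a sA < #|A| by rewrite -size_order_seq index_mem mem_order_seq.
have lti : i < (#|A| %/ q.+1).+1 by rewrite ltnS leq_divRL // -Ei ltnW.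
by apply/imsetP; exists (Ordinal lti) => //; rewrite /f /= -Ei nth_index //
  mem_order_seq.
Qed.

End Ranks.

Section Data.

Variables (V : finType) (E le : rel V) (t : int) (k : nat).
Hypotheses (properE : proper_order t E le) (le_tk : (t + 2 <= k%:Z)%R).
Variables (S : {set V}) (m0 : V).
Let rk := rank le.
Hypotheses (Sm0 : m0 \in S) (m0_min : forall s, s \in S -> rk m0 <= rk s).

(** Finite choice over all sets [L]; those violating the assumptions receive the dummy value [(m0,
    m0, [::])]. *)
Lemma runs_data : exists runs_of : {set V} -> V * V * seq V,
  forall L h c ds, runs_of L = (h, c, ds) -> L \subset S :\ m0 -> L != set0 ->
  (forall h', h' \in L -> split_rows E le rk S m0 h' != set0) ->
  [/\ h \in L, c \in split_rows E le rk S m0 h,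
      forall x, x \in split_rows E le rk S m0 h -> rk c <= rk x,
      runs rk (split_rows E le rk S m0 h) (touched E le rk m0 L) (4 * k) c ds
    & size ds < k].
Proof.
have [tot STO] := properE; have rk_inj := rank_inj tot.
have leE : forall x y, le x y = (rk x <= rk y) by apply: rankE.
have [pi [mono_pi blocks pi_inj]] := adj_quotient tot E.
suff /fin_all_exists[runs_of runs_ofP] : forall L : {set V}, exists d : V * V *
  seq V,
    L \subset S :\ m0 -> L != set0 ->
    (forall h', h' \in L -> split_rows E le rk S m0 h' != set0) ->
    [/\ d.1.1 \in L, d.1.2 \in split_rows E le rk S m0 d.1.1,
        forall x, x \in split_rows E le rk S m0 d.1.1 -> rk d.1.2 <= rk x,
        runs rk (split_rows E le rk S m0 d.1.1) (touched E le rk m0 L) (4 * k)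
          d.1.2 d.2
      & size d.2 < k].
  by exists runs_of => L h c ds ed; have := runs_ofP L; rewrite ed.
move=> L; have [L_S|nL] := boolP (L \subset S :\ m0); last first.
  by exists (m0, m0, [::]) => H; case/negP: nL.
have [->|L0] := eqVneq L set0; first by exists (m0, m0, [::]) => _ /eqP[].
have [h Lh [n1 [part [mono_part few small]]]] :=
  stage_bounds rk_inj leE Sm0 m0_min L_S le_tk STO mono_pi blocks pi_inj L0.
have [D0|/set0Pn[x0 Dx0]] := eqVneq (split_rows E le rk S m0 h) set0.
  by exists (m0, m0, [::]) => _ _ /(_ h Lh); rewrite D0 eqxx.
case: (@arg_minnP _ x0 (fun x => x \in split_rows E le rk S m0 h) rk Dx0) => c
  Dc c_min.
have mono := @touched_mono V E le rk leE m0 L.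
have [ds runs_ds size_ds] := runs_ex rk_inj (D := split_rows E le rk S m0 h)
  mono_part small Dc.
exists (h, c, ds) => _ _ _; split=> //=.
apply: leq_trans size_ds _; apply: leq_trans few.
apply: subset_leq_card; apply/subsetP => _ /imsetP[x + ->].
by rewrite inE => /andP[Dx _]; apply: imset_f.
Qed.

End Data.

(** * The cutting *)

Section Slots.

Variables (M K : nat).

(** Four slots hold [m0], [s1] and the ends of the break, two hold each entry of the walk, and four
    each row entry. *)
Definition slot : finType := ('I_4 + 'I_M * bool + 'I_K * 'I_4)%type.

Definition slot0 (i : 'I_4) : slot := inl (inl i).
Definition slot1 (i : 'I_M) (b : bool) : slot := inl (inr (i, b)).
Definition slot2 (i : 'I_K) (j : 'I_4) : slot := inr (i, j).

Lemma card_slot : #|slot| = 4 + M * 2 + K * 4.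
Proof. by rewrite !card_sum !card_prod !card_ord card_bool. Qed.

Definition parameters (V : finType) (f : slot -> V) : #|slot|.-tuple V :=
  [tuple f (enum_val i) | i < #|slot|].

Lemma parameter_variables : exists var : slot -> 'I_(#|slot|).+1,
  forall (V : finType) (f : slot -> V) x s,
    tnth [tuple of x :: parameters f] (var s) = f s.
Proof.
exists (fun s => lift ord0 (enum_rank s)) => V f x s.
by rewrite tnthS tnth_mktuple enum_rankK.
Qed.

Lemma map_nth_enum (T T' : Type) n (F : T -> T') x0 (s : seq T) : size s = n ->
  [seq F (nth x0 s i) | i : 'I_n <- enum 'I_n] = map F s.
Proof.
move=> sz; rewrite -sz; apply: (@eq_from_nth _ (F x0)).
  by rewrite size_map size_enum_ord size_map.
move=> i; rewrite size_map size_enum_ord => lti.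
rewrite (nth_map (Ordinal lti)) ?size_enum_ord // (nth_map x0) //.
by rewrite (nth_ord_enum _ (Ordinal lti)).
Qed.

Let o4 (i : nat) : 'I_4 := inord i.

Lemma cell_formula : exists psi : formula (#|slot|).+1,
  forall (V : finType) (E le : rel V) (f : slot -> V)
    (m c p h : V) (es : seq (V * V)) (gs : seq (V * V * V * V)) x,
  f (slot0 (o4 0)) = m -> f (slot0 (o4 1)) = c -> f (slot0 (o4 2)) = p ->
  f (slot0 (o4 3)) = h ->
  [seq (f (slot1 i true), f (slot1 i false)) | i : 'I_M <- enum 'I_M] = es ->
  [seq (f (slot2 i (o4 0)), f (slot2 i (o4 1)), f (slot2 i (o4 2)),
        f (slot2 i (o4 3))) | i : 'I_K <- enum 'I_K] = gs ->
  sat E le psi [tuple of x :: parameters f] = cell_pred E le m c p h es gs x.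
Proof.
have [var varE] := parameter_variables.
have [psi psiE] := fo_cell_pred (var (slot0 (o4 0))) (var (slot0 (o4 1)))
  (var (slot0 (o4 2))) (var (slot0 (o4 3)))
  [seq (var (slot1 i true), var (slot1 i false)) | i : 'I_M <- enum 'I_M]
  [seq (var (slot2 i (o4 0)), var (slot2 i (o4 1)), var (slot2 i (o4 2)),
        var (slot2 i (o4 3))) | i : 'I_K <- enum 'I_K] ord0.
exists psi => V E le f m c p h es gs x <- <- <- <- <- <-.
rewrite psiE tnth0 !varE -map_comp -map_comp.
rewrite (eq_map (g := fun i => (f (slot1 i true), f (slot1 i false)))); last
  first.
  by move=> i; rewrite /comp /at2 [LHS]/= !varE.
rewrite (eq_map (g := fun i => (f (slot2 i (o4 0)), f (slot2 i (o4 1)),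
  f (slot2 i (o4 2)), f (slot2 i (o4 3))))) //.
by move=> i; rewrite /comp /at4 !varE.
Qed.
End Slots.

Lemma partition_by_key (V : finType) (T : eqType) (f : V -> T) (X : {set V}) :
  X \in preim_partition f [set: V] -> exists v, X = [set x | f x == f v].
Proof.
case/imsetP=> v _ ->; exists v; apply/setP => x.
by rewrite !inE eq_sym.
Qed.

(** Classes are counted through their parameters: each is defined by a tuple from [S], so there are
    at most [#|S| ^ l] of them. The assumption on [q] provides two elements of [S]; the first clause
    of the conclusion is for a set [A] with one element. *)
Lemma definable_cutting (t : int) (k : nat) : 0 < k -> (t + 2 <= k%:Z)%R ->
  let l := #|slot (5 * k) (4 * k)| in
  exists psi : formula l.+1,
  (forall (V : finType) (E le : rel V) (x a : V),
     sat E le psi [tuple of x :: nseq_tuple l a]) /\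
  forall (V : finType) (E le : rel V), proper_order t E le ->
  forall (A : {set V}) (q : nat), q.+1 < #|A| ->
  exists P : {set {set V}},
    [/\ partition P [set: V], #|P| <= (#|A| %/ q.+1).+1 ^ l
      & forall X, X \in P -> #|[set a in A | crosses E a X]| <= 4 * k * q /\
          exists2 a : l.-tuple V, {subset a <= A} & X = defset E le psi a].
Proof.
(* [K] bounds the cells of a run, and [M] is the sum of [k] jumps and [K] cells. *)
move=> k_gt0 le_tk; set K := 4 * k; set M := 5 * k => l.
have [psi psiE] := cell_formula M K; exists psi; split.
  move=> V E le x a.
  have -> : nseq_tuple l a = parameters (fun _ : slot M K => a).
    by apply: eq_from_tnth => i; rewrite tnth_mktuple (tnth_nth a) nth_nseq
      ltn_ord.
  by rewrite (psiE V E le (fun=> a) a a a a _ _ x erefl erefl erefl erefl erefl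
    erefl)
    /cell_pred eqxx.
move=> V E le properE A q ltq; have [tot _] := properE.
pose rk := rank le; have rk_inj : injective rk by apply: rank_inj.
have leE : forall x y, le x y = (rk x <= rk y) by apply: rankE.
pose sA := order_seq le A; pose S := spaced le A q.
have [x0 Ax0] : exists x0, x0 \in A by apply/set0Pn; rewrite -card_gt0; apply:
  leq_trans ltq.
have A_gt0 : 0 < #|A| by apply: leq_trans ltq.
pose m0 := nth x0 sA 0; pose s1 := nth x0 sA q.+1.
have Sm0 : m0 \in S by apply: (@mem_nth_spaced V le A q x0 0); rewrite mul0n.
have Ss1 : s1 \in S.
  by have := @mem_nth_spaced V le A q x0 1; rewrite mul1n; apply.
have S_A : S \subset A by apply/subsetP => s; rewrite inE => /andP[].
have A_m0 a : a \in A -> rk m0 <= rk a.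
  by move=> Aa; rewrite /rk (rank_sA tot (subsetP S_A _ Sm0) Aa) index_sA.
have m0_min s : s \in S -> rk m0 <= rk s by move/(subsetP S_A); apply: A_m0.
have neq_s1 : s1 != m0.
  apply/eqP => e; have := index_sA le x0 ltq.
  by rewrite -/sA -/s1 e /m0 index_sA.
have [runs_of runs_ofP] := runs_data properE le_tk Sm0 m0_min.
pose keyf := key E le rk S m0 runs_of.
have class v : exists2 f : {ffun slot M K -> V}, f \in ffun_on (mem S) &
    [set x | keyf x == keyf v] = defset E le psi (parameters f) /\
    #|[set a in A | crosses E a [set x | keyf x == keyf v]]| <= K * q.
  have sub : breaks E le rk S m0 v \subset S :\ m0 by apply: breaks_sub.
  have /fin_all_exists[mh mhP] : forall g : V, exists mh : V * V,
      g \in heads m0 (breaks E le rk S m0 v) ->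
      [/\ mh.1 \in S, mh.2 \in S, rk g <= rk mh.1, rk g <= rk mh.2
      & (forall z, rk m0 <= rk z -> incell le (g, mh.2) z =
           (cellof rk m0 (breaks E le rk S m0 v) z == g)) /\
        ((mh.2 = g /\ forall s, s \in S -> rk s <= rk mh.1) \/
         [/\ mh.2 \in breaks E le rk S m0 v, prev rk S m0 mh.2 = mh.1
           & rk g < rk mh.2])].
    move=> g; have [Hg|nHg] := boolP (g \in heads m0 (breaks E le rk S m0 v)).
      have [mid [hi H]] := cell_bounds rk_inj leE Sm0 m0_min sub Hg.
      by exists (mid, hi).
    by exists (m0, m0) => H; case/negP: nHg.
  have K_gt0 : 0 < K by rewrite muln_gt0.
  have leM : k + K <= M by rewrite /K /M; lia.
  have [p [h [os [ros [size_os size_ros [Sp Sh] [ok_os ok_ros] [memE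
    crossK]]]]]] :=
    class_definable rk_inj leE Sm0 m0_min Ss1 neq_s1 K_gt0 runs_ofP mhP A_m0
      (spaced_gaps tot (q := q)) leM.
  set L := breaks E le rk S m0 v in mhP ok_os ok_ros *.
  set mid := fun g => (mh g).1 in memE *; set hi := fun g => (mh g).2 in memE *.
  set cd := code m0 s1 hi in memE; set entry := row_entry E m0 s1 mid hi v in
    memE.
  pose f (s : slot M K) := match s with
    | inl (inl i) => nth m0 [:: m0; s1; p; h] i
    | inl (inr (i, b)) =>
        let c := cd (nth None os i) in if b then c.1 else c.2
    | inr (i, j) => let g := entry (nth None ros i) in
        nth m0 [:: g.1.1.1; g.1.1.2; g.1.2; g.2] j
    end.
  have inS (s : seq V) i : all (mem S) s -> nth m0 s i \in S.
    move=> /allP H; have [lti|lei] := ltnP i (size s); last by rewrite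
      nth_default.
    exact/H/mem_nth.
  have headS (s : seq (option V)) i g : cells s \subset heads m0 L ->
      nth None s i = Some g -> g \in heads m0 L.
    move=> /subsetP H e; apply: H; rewrite inE -e; apply: mem_nth.
    by rewrite ltnNge; apply/negP => lei; rewrite nth_default in e.
  have f_S s : f s \in S.
    case: s => [[i|[i b]]|[i j]] /=.
    - by apply: inS; rewrite /= Sm0 Ss1 Sp Sh.
    - case e: (nth None os i) => [g|] /=; last by case: b.
      have Hg := headS _ _ _ ok_os e; have [_ Shi _ _ _] := mhP g Hg.
      by case: b => //; apply: (heads_S rk_inj Sm0 m0_min sub Hg).
    apply: inS; case e: (nth None ros i) => [g|] /=; last by rewrite Sm0 Ss1.
    have Hg := headS _ _ _ ok_ros e; have [Smid Shi _ _ _] := mhP g Hg.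
    have Sg := heads_S rk_inj Sm0 m0_min sub Hg.
    by rewrite Sg Smid Shi /=; case: (E v g) => //=; rewrite ?Sg //; case: eqP;
      rewrite ?Ss1 ?Sm0.
  exists (finfun f); first by apply/ffun_onP => s; rewrite ffunE.
  have -> : parameters (finfun f) = parameters f.
    by apply: eq_from_tnth => i; rewrite !tnth_mktuple ffunE.
  split=> //; apply/setP => x; rewrite !inE -memE; apply/esym.
  have ord4 i (lti : i < 4) : (@inord 3 i : nat) = i by apply: inordK.
  apply: psiE; rewrite /f /= ?ord4 //.
    rewrite -(map_nth_enum cd None size_os); apply: eq_map => i.
    by case: (cd _).
  rewrite -(map_nth_enum entry None size_ros); apply: eq_map => i.
  by case: (entry _) => [[[? ?] ?] ?].
exists (preim_partition keyf [set: V]); split; first exact: preim_partitionP.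
  apply: leq_trans (_ : #|S| ^ l <= _); last by rewrite leq_exp2r ?card_spaced
    // /l card_slot.
  rewrite -[l]/(#|slot M K|) -(@card_ffun_on (slot M K) V (mem S)).
  apply: leq_trans (leq_imset_card (fun f : {ffun slot M K -> V} => defset E le
    psi (parameters f)) _).
  apply: subset_leq_card; apply/subsetP => X /partition_by_key[v ->].
  by have [f f_S [-> _]] := class v; apply: imset_f.
move=> X /partition_by_key[v ->]; have [f /ffun_onP f_S [eX cX]] := class v.
split=> //; exists (parameters f) => // a /mapP[i _ ->].
exact/(subsetP S_A)/f_S.
Qed.

(** The choice is the integer part of [n / (r * K)]. The last bound absorbs the successor by
    [1 <= r], and [2 < K] ensures [q.+1 < n]. *)
Lemma spacing (R : realType) (K n : nat) (r : R) : (2 < K)%N -> (1 < n)%N ->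
  (1 <= r)%R -> exists q, [/\ (q.+1 < n)%N, ((K * q)%:R <= n%:R / r :> R)%R
    & ((n %/ q.+1).+1%:R <= (K.+1)%:R * r :> R)%R].
Proof.
move=> K_gt2 n_gt1 r1; have r_gt0 : (0 < r)%R by apply: lt_le_trans r1.
have K_gt0 : (0 < K%:R :> R)%R by rewrite ltr0n; lia.
have rK_gt0 : (0 < r * K%:R :> R)%R by rewrite mulr_gt0.
pose y : R := (n%:R / (r * K%:R))%R; have y_ge0 : (0 <= y)%R by rewrite
  divr_ge0 // ltW.
have /andP[le_q lt_q] := truncn_itv y_ge0.
have Eq : (y * K%:R = n%:R / r)%R.
  by rewrite /y invfM -!mulrA mulVf ?mulr1 // gt_eqF.
exists (Num.truncn y); split.
- have : ((Num.truncn y * K)%:R <= n%:R :> R)%R.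
    rewrite natrM; apply: le_trans (_ : y * K%:R <= _)%R.
      by rewrite ler_pM2r.
    by rewrite Eq ler_pdivrMr // ler_peMr.
  rewrite ler_nat; nia.
- by rewrite natrM mulrC -Eq ler_pM2r.
rewrite -natr1 -[(K.+1%:R)%R]natr1 mulrDl mul1r lerD //.
apply: le_trans (_ : n%:R / (Num.truncn y).+1%:R <= _)%R.
  rewrite ler_pdivlMr ?ltr0n // -natrM ler_nat; exact: leq_divM.
rewrite ler_pdivrMr ?ltr0n // mulrC [(K%:R * r)%R]mulrC -ler_pdivrMr //.
exact: ltW.
Qed.

Local Open Scope ring_scope.

Theorem theorem6 (R : realType) :
  exists K : nat, forall t : int,
  exists (C : R) (e l : nat) (psi : formula l.+1),
    [/\ (l <= K * (absz t).+1)%N,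
        (e <= K * (absz t).+1)%N
      & forall (V : finType) (E le : rel V),
        simple_graph E -> proper_order t E le ->
        forall (A : {set V}) (n : nat) (r : R),
        #|A| = n -> 1 <= r -> r <= n%:R ->
        exists P : {set {set V}},
          [/\ partition P [set: V],
              #|P|%:R <= C * r ^+ e
            & forall X : {set V}, X \in P ->
                #|[set a in A | crosses E a X]|%:R <= n%:R / r /\
                exists a b : l.-tuple V,
                  [/\ {subset a <= A}, {subset b <= A}
                    & X = defset E le psi a :&: defset E le psi b]]].
Proof.
(* The number of parameters is [4 + 26 * k], which equals [56 + 26 * absz t]. *)
exists 56%N => t; pose k := (absz t + 2)%N.
have le_tk : t + 2 <= k%:Z by rewrite /k; lia.
have k_gt0 : (0 < k)%N by rewrite /k addn2.
have [psi [psiT psiP]] := definable_cutting k_gt0 le_tk.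
set l := #|_| in psi psiT psiP *.
have le_l : (l <= 56 * (absz t).+1)%N by rewrite /l card_slot /k; lia.
(* By [spacing], [S] has at most [(4 * k).+1 * r] elements; the constant is the [l]-th power of the
   first factor. *)
exists ((4 * k).+1%:R ^+ l), l, l, psi; split=> // V E le _ properE A n r cardA r1 rn.
have r_gt0 : 0 < r by apply: lt_le_trans r1.
have n_gt0 : (0 < n)%N by rewrite -(ltr0n R); apply: lt_le_trans rn.
(* If [n = 1] then [r = 1], and the whole vertex set, defined by a constant tuple, is the only
   class. *)
have [n1|n_gt1] := leqP n 1.
  have en : n = 1%N by apply/eqP; rewrite eqn_leq n1.
  rewrite en in cardA rn *; have er : r = 1 by apply/eqP; rewrite eq_le r1 andbT.
  have /card_gt0P[a0 Aa0] : (0 < #|A|)%N by rewrite cardA.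
  have T0 : [set: V] != set0 by apply/set0Pn; exists a0; rewrite inE.
  exists [set [set: V]]; split=> [||X /set1P ->].
  - by rewrite /partition cover1 trivIset1 eqxx inE eq_sym T0.
  - by rewrite cards1 er expr1n mulr1 -natrX ler1n expn_gt0.
  split.
    rewrite er divr1 ler_nat -cardA; apply: subset_leq_card.
    by apply/subsetP => a; rewrite inE => /andP[].
  have constA : {subset nseq_tuple l a0 <= A}.
    by move=> a /nseqP[-> _].
  exists (nseq_tuple l a0), (nseq_tuple l a0); split=> //.
  by rewrite setIid; apply/setP => x; rewrite !inE psiT.
have [q [lt_q small_q big_q]] := @spacing R (4 * k) n r ltac:(rewrite /k; lia) n_gt1 r1.
rewrite -cardA in lt_q; have [P [partP cardP cellP]] := psiP V E le properE A q lt_q.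
exists P; split=> // [|X PX].
  rewrite -exprMn; apply: le_trans (_ : (#|A| %/ q.+1).+1%:R ^+ l <= _).
    by rewrite -natrX ler_nat.
  by rewrite lerXn2r ?nnegrE ?ler0n ?mulr_ge0 ?ler0n ?(ltW r_gt0) // cardA.
have [crX [a aA eX]] := cellP X PX; split; last by exists a, a; rewrite setIid.
by apply: le_trans small_q; rewrite ler_nat.
Qed.
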